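(* Let $K$ be a compact line and let $X$ be a closed linear subspace of $C(K)$ whose dual space $X^*$ is (norm-)separable. Then $X$ has the $c_0$-extension property in $C(K)$; that is, every bounded linear operator $T:X\to c_0$ admits a bounded linear extension $T':C(K)\to c_0$.
   Context: A compact line is a (nonempty) linearly ordered set which is compact in the order topology. $C(K)$ denotes the Banach space of continuous real-valued functions on $K$ with the supremum norm; Banach spaces are real. A closed subspace $Y$ of a Banach space $Z$ has the $c_0$-extension property in $Z$ if every bounded operator $T:Y\to c_0$ admits a bounded extension $Z\to c_0$. *)

(* Defs.v *)
From HB Require Import structures.
From mathcomp Require Import all_boot all_order all_algebra.
From mathcomp Require Import all_classical all_reals all_analysis.

Set Implicit Arguments.
Unset Strict Implicit.
Unset Printing Implicit Defensive.

Import Order.TTheory GRing.Theory Num.Theory.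
Import numFieldNormedType.Exports.

Local Open Scope classical_set_scope.
Local Open Scope ring_scope.

(* Compactness is packed into the type of the space so that the sup norm can
   be declared as a canonical normed structure. *)
HB.mixin Record isCompactSpace T & Topological T := {
  compact_setT : compact [set: T]
}.

#[short(type="compactSpaceType")]
HB.structure Definition CompactSpace := {T of Topological T & isCompactSpace T}.

HB.mixin Record isNonempty (T : Type) := {
  nonempty_setT : [set: T] !=set0
}.

#[short(type="nonemptyType")]
HB.structure Definition Nonempty := {T of isNonempty T}.

#[short(type="compactLineType")]
HB.structure Definition CompactLine d :=
  {T of OrderTopological d T & isCompactSpace T & isNonempty T}.

Definition separable (T : topologicalType) :=
  exists2 D : set T, countable D & dense D.

Section sup_norm.
Context {R : realType} {T : Type} {W : normedModType R}.
Implicit Types (D : set T) (f g : T -> W).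

(* Note that [sup set0 = 0], so this is also right for an empty [D]. *)
Definition sup_norm D f : R := sup [set `|f t| | t in D].

Definition bounded_on D f := exists M : R, forall t, D t -> `|f t| <= M.

Lemma sup_norm_ub D f t : bounded_on D f -> D t -> `|f t| <= sup_norm D f.
Proof.
move=> [M fM] Dt; apply: ub_le_sup; last by exists t.
by exists M => _ [s Ds <-]; exact: fM.
Qed.

Lemma sup_norm_le D f (M : R) :
  0 <= M -> (forall t, D t -> `|f t| <= M) -> sup_norm D f <= M.
Proof.
move=> M0 fM; have [->|/set0P[t Dt]] := eqVneq D set0.
  by rewrite /sup_norm image_set0 sup0.
apply: ge_sup; first by exists `|f t|, t.
by move=> _ [s Ds <-]; exact: fM.
Qed.

Lemma sup_norm_ge0 D f : bounded_on D f -> 0 <= sup_norm D f.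
Proof.
move=> bf; have [->|/set0P[t Dt]] := eqVneq D set0.
  by rewrite /sup_norm image_set0 sup0.
exact: le_trans (normr_ge0 (f t)) (sup_norm_ub bf Dt).
Qed.

Lemma sup_normD D f g : bounded_on D f -> bounded_on D g ->
  sup_norm D (f + g) <= sup_norm D f + sup_norm D g.
Proof.
move=> bf bg; apply: sup_norm_le => [|t Dt].
  by rewrite addr_ge0 ?sup_norm_ge0.
by rewrite (le_trans (ler_normD _ _))// lerD// sup_norm_ub.
Qed.

Lemma bounded_onZ D (l : R) f : bounded_on D f -> bounded_on D (l *: f).
Proof.
move=> [M fM]; exists (`|l| * M) => t Dt.
by rewrite [(l *: f) t]/(l *: f t) normrZ ler_wpM2l// fM.
Qed.

Lemma sup_normZ D (l : R) f :
  bounded_on D f -> sup_norm D (l *: f) = `|l| * sup_norm D f.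
Proof.
have le k h : bounded_on D h -> sup_norm D (k *: h) <= `|k| * sup_norm D h.
  move=> bh; apply: sup_norm_le => [|t Dt]; first by rewrite mulr_ge0 ?sup_norm_ge0.
  by rewrite [(k *: h) t]/(k *: h t) normrZ ler_wpM2l// sup_norm_ub.
move=> bf; apply/eqP; rewrite eq_le le//=.
have [->|l0] := eqVneq l 0.
  by rewrite normr0 mul0r sup_norm_ge0//; exact: bounded_onZ.
have := le l^-1 _ (bounded_onZ l bf).
by rewrite scalerA mulVf// scale1r normfV ler_pdivlMl ?normr_gt0.
Qed.

Lemma sup_norm_eq0 D f :
  bounded_on D f -> sup_norm D f = 0 -> forall t, D t -> f t = 0.
Proof.
move=> bf f0 t Dt; apply/eqP.
by rewrite -normr_le0 -f0 sup_norm_ub.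
Qed.

End sup_norm.

Section continuous_functions.
Context (K : compactSpaceType) (R : realType).

Definition continuous_pred : {pred K -> R} := fun f => `[< continuous f >].

Lemma continuous_pred_submod_closed : submod_closed continuous_pred.
Proof.
split=> [|l f g]; first by apply/asboolP => x; exact: cvg_cst.
move=> /asboolP cf /asboolP cg; apply/asboolP => x.
by apply: cvgD; [apply: cvgZl_tmp; exact: cf|exact: cg].
Qed.

HB.instance Definition _ := GRing.isSubmodClosed.Build R (K -> R)
  continuous_pred (GRing.submod_closed_semi continuous_pred_submod_closed).

Definition cfun := {f : K -> R | f \in continuous_pred}.

HB.instance Definition _ := SubChoice.on cfun.
HB.instance Definition _ := [SubChoice_isSubLmodule of cfun by <:].

Definition cfun_fun (f : cfun) : K -> R := val f.
Coercion cfun_fun : cfun >-> Funclass.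

Lemma cfun_continuous (f : cfun) : continuous f.
Proof. exact/asboolP/(valP f). Qed.

Lemma cfun_bounded (f : cfun) : bounded_on [set: K] f.
Proof.
have cf : {within [set: K], continuous f}.
  exact/continuous_subspaceT/cfun_continuous.
have /compact_bounded/pinfty_ex_gt0[M _ fM] := continuous_compact cf compact_setT.
by exists M => t _; apply: fM; exists t.
Qed.

Definition cfun_norm (f : cfun) : R := sup_norm [set: K] f.

Lemma cfun_normD f g : cfun_norm (f + g) <= cfun_norm f + cfun_norm g.
Proof. exact: sup_normD (cfun_bounded f) (cfun_bounded g). Qed.

Lemma cfun_normZ l f : cfun_norm (l *: f) = `|l| * cfun_norm f.
Proof. exact: sup_normZ (cfun_bounded f). Qed.

Lemma cfun_norm_eq0 f : cfun_norm f = 0 -> f = 0.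
Proof.
move=> f0; apply/val_inj/funext => t.
exact: (sup_norm_eq0 (cfun_bounded f) f0).
Qed.

HB.instance Definition _ :=
  Lmodule_isNormed.Build R cfun cfun_normD cfun_normZ cfun_norm_eq0.

End continuous_functions.

Notation "C( K , R )" := (@cfun K R)
  (at level 0, K at level 99, R at level 99, format "C( K ,  R )") : type_scope.

Section null_sequences.
Context (R : realType).

Definition null_pred : {pred nat -> R} := fun u => `[< u @ \oo --> (0 : R) >].

Lemma null_pred_submod_closed : submod_closed null_pred.
Proof.
split=> [|l u v]; first by apply/asboolP; exact: cvg_cst.
move=> /asboolP cu /asboolP cv; apply/asboolP.
rewrite -[0 : R](addr0 (0 : R)) -{1}(scaler0 _ l).
by apply: cvgD => //; exact: cvgZl_tmp.
Qed.

HB.instance Definition _ := GRing.isSubmodClosed.Build R (nat -> R)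
  null_pred (GRing.submod_closed_semi null_pred_submod_closed).

Definition c0 := {u : nat -> R | u \in null_pred}.

HB.instance Definition _ := SubChoice.on c0.
HB.instance Definition _ := [SubChoice_isSubLmodule of c0 by <:].

Definition c0_fun (u : c0) : nat -> R := val u.
Coercion c0_fun : c0 >-> Funclass.

Lemma c0_cvg (u : c0) : u @ \oo --> (0 : R).
Proof. exact/asboolP/(valP u). Qed.

Lemma c0_bounded (u : c0) : bounded_on [set: nat] u.
Proof.
have /cvgP/cvg_seq_bounded/pinfty_ex_gt0[M _ uM] := @c0_cvg u.
by exists M.
Qed.

Definition c0_norm (u : c0) : R := sup_norm [set: nat] u.

Lemma c0_normD u v : c0_norm (u + v) <= c0_norm u + c0_norm v.
Proof. exact: sup_normD (c0_bounded u) (c0_bounded v). Qed.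

Lemma c0_normZ l u : c0_norm (l *: u) = `|l| * c0_norm u.
Proof. exact: sup_normZ (c0_bounded u). Qed.

Lemma c0_norm_eq0 u : c0_norm u = 0 -> u = 0.
Proof.
move=> u0; apply/val_inj/funext => n.
exact: (sup_norm_eq0 (c0_bounded u) u0).
Qed.

HB.instance Definition _ :=
  Lmodule_isNormed.Build R c0 c0_normD c0_normZ c0_norm_eq0.

End null_sequences.

Section bounded_operators.
Context {R : realType} (V W : normedModType R).

Definition bounded_operator_pred : {pred V -> W} := fun T =>
  `[< linear T /\ exists M : R, forall x, `|T x| <= M * `|x| >].

Lemma bounded_operator_pred_submod_closed :
  submod_closed bounded_operator_pred.
Proof.
split=> [|l S T].
  apply/asboolP; split=> [a x y|]; first by rewrite scaler0 addr0.
  by exists 0 => x; rewrite mul0r normr0.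
move=> /asboolP[lS [M SM]] /asboolP[lT [N TN]]; apply/asboolP; split=> [a x y|].
  rewrite ![(l *: S + T) _]/(l *: S _ + T _) lS lT !scalerDr !scalerA.
  by rewrite [l * a]mulrC addrACA.
exists (`|l| * M + N) => x; rewrite mulrDl -mulrA.
rewrite [(l *: S + T) _]/(l *: S _ + T _) (le_trans (ler_normD _ _))//.
by rewrite normrZ lerD// ler_wpM2l.
Qed.

HB.instance Definition _ := GRing.isSubmodClosed.Build R (V -> W)
  bounded_operator_pred
  (GRing.submod_closed_semi bounded_operator_pred_submod_closed).

Definition bounded_operator := {T : V -> W | T \in bounded_operator_pred}.

HB.instance Definition _ := SubChoice.on bounded_operator.
HB.instance Definition _ := [SubChoice_isSubLmodule of bounded_operator by <:].

Definition bounded_operator_fun (T : bounded_operator) : V -> W := val T.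
Coercion bounded_operator_fun : bounded_operator >-> Funclass.

Lemma bounded_operator_linear (T : bounded_operator) : linear T.
Proof. by have /asboolP[] := valP T. Qed.

HB.instance Definition _ (T : bounded_operator) :=
  GRing.isLinear.Build R V W *:%R (bounded_operator_fun T)
    (bounded_operator_linear T).

Lemma bounded_operator_bounded (T : bounded_operator) :
  exists M : R, forall x, `|T x| <= M * `|x|.
Proof. by have /asboolP[] := valP T. Qed.

Lemma bounded_operator_bounded_on (T : bounded_operator) :
  bounded_on [set x | `|x| <= 1] T.
Proof.
have [M TM] := bounded_operator_bounded T; exists `|M| => x /= x1.
rewrite (le_trans (TM x))// (le_trans (ler_norm _))// normrM normr_id.
by rewrite -[leRHS]mulr1 ler_wpM2l.
Qed.

Definition operator_norm (T : bounded_operator) : R :=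
  sup_norm [set x | `|x| <= 1] T.

Lemma operator_normD S T :
  operator_norm (S + T) <= operator_norm S + operator_norm T.
Proof.
exact: sup_normD (bounded_operator_bounded_on S) (bounded_operator_bounded_on T).
Qed.

Lemma operator_normZ l T : operator_norm (l *: T) = `|l| * operator_norm T.
Proof. exact: sup_normZ (bounded_operator_bounded_on T). Qed.

Lemma operator_norm_eq0 T : operator_norm T = 0 -> T = 0.
Proof.
move=> T0; have T0' := sup_norm_eq0 (bounded_operator_bounded_on T) T0.
apply/val_inj/funext => x; rewrite -[LHS]/(T x) [RHS]/(0 : W).
have [->|x0] := eqVneq x 0; first by rewrite linear0.
have := T0' (`|x|^-1 *: x); rewrite /= normfZV// linearZ => /(_ (lexx _))/eqP.
by rewrite scaler_eq0 invr_eq0 normr_eq0 (negbTE x0) => /eqP.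
Qed.

HB.instance Definition _ := Lmodule_isNormed.Build R bounded_operator
  operator_normD operator_normZ operator_norm_eq0.

End bounded_operators.

Definition dual {R : realType} (V : normedModType R) := bounded_operator V R.
Identity Coercion operator_of_dual : dual >-> bounded_operator.

HB.instance Definition _ (R : realType) (V : normedModType R) :=
  NormedModule.on (dual V).

Section subspaces.
Context {R : realType} {V : normedModType R} (X : submodClosed V).

Definition subnormed := {x : V | x \in X}.

HB.instance Definition _ := SubChoice.on subnormed.
HB.instance Definition _ := [SubChoice_isSubLmodule of subnormed by <:].

Definition subnormed_norm (x : subnormed) : R := `|val x|.

Lemma subnormed_normD x y :
  subnormed_norm (x + y) <= subnormed_norm x + subnormed_norm y.
Proof. exact: ler_normD. Qed.

Lemma subnormed_normZ l x : subnormed_norm (l *: x) = `|l| * subnormed_norm x.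
Proof. exact: normrZ. Qed.

Lemma subnormed_norm_eq0 x : subnormed_norm x = 0 -> x = 0.
Proof. by move=> /normr0_eq0 x0; exact: val_inj. Qed.

HB.instance Definition _ := Lmodule_isNormed.Build R subnormed
  subnormed_normD subnormed_normZ subnormed_norm_eq0.

End subspaces.

Definition c0_extension_property (R : realType) (Z : normedModType R)
    (Y : submodClosed Z) :=
  forall T : bounded_operator (subnormed Y) (c0 R),
  exists T' : bounded_operator Z (c0 R), forall y : subnormed Y, T' (val y) = T y.

(* Main.v *)
(* Let [T_n] be the coordinates of [T]. By Hahn-Banach and Veech's argument they
   extend to bounded finitely additive measures [phi_n] on [K] that tend to [0] on
   the initial segments with end point in a given countable set [C], chosen so
   that elements of [X] are uniform limits of step functions with jumps in [C].
   A bounded sequence of measures is weak* null on [C(K)] as soon as it tends to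
   [0] on every initial segment, so what remains to be repaired is the behaviour
   at the uncountably many initial segments ending outside of [C]. Since [X^*] is separable, [t |-> delta_t] has norm-separable range in
   [X^*], so a Baire category argument produces, in any interval that cannot yet
   be repaired, a smaller one on which outside of the intervals already repaired
   all of [X] is constant up to [eps]. There one subtracts from [phi_n] its image
   under a retraction of the interval onto that remaining set; the retraction is
   continuous at the points of the set, which exists because [K] is a line. The
   repaired measures approximate [T_n] on [X] up to a factor [1/2] of the norm,
   and iterating gives a geometric series whose sum is the extension. *)

Require Import Defs.
From HB Require Import structures.
From mathcomp Require Import all_boot all_order all_algebra.
From mathcomp Require Import all_classical all_reals all_analysis.
From mathcomp Require Import lra.

Set Implicit Arguments.
Unset Strict Implicit.
Unset Printing Implicit Defensive.

Import Order.TTheory GRing.Theory Num.Theory.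
Import numFieldNormedType.Exports.

Local Open Scope classical_set_scope.
Local Open Scope ring_scope.

(** * Filters, ultrafilter limits and the Hahn-Banach theorem *)

(** In later constructions a parameter [k], such as an accuracy or a number of intervals, must grow
    with [n], but slowly enough for [Q k n] to have set in. [kappa n] is the largest [k] whose
    threshold [S k] is at most [n]. *)
Lemma nat_diagonal (Q : nat -> nat -> Prop) :
  (forall k, \forall n \near \oo, Q k n) ->
  exists kappa : nat -> nat,
    (forall m, \forall n \near \oo, (m <= kappa n)%N) /\
    \forall n \near \oo, Q (kappa n) n.
Proof.
move=> QP.
have /choice[N NP] : forall k, exists N, forall n, (N <= n)%N -> Q k n.
  by move=> k; have [N _ NQ] := QP k; exists N => n Nn; exact: NQ.
(* [S] dominates [N], and also the identity, so that every [k] with [S k <= n] lies below [n.+1]. *)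
pose S k := (k + \sum_(i < k.+1) N i)%N.
have SN k : (N k <= S k)%N.
  by rewrite /S big_ord_recr/= addnA leq_addl.
have kS k : (k <= S k)%N by rewrite leq_addr.
have Sle k l : (k <= l)%N -> (S k <= S l)%N.
  elim: l => [|l IH]; first by rewrite leqn0 => /eqP ->.
  rewrite leq_eqVlt => /orP[/eqP ->//|/IH /leq_trans]; apply.
  by rewrite /S [in leqRHS]big_ord_recr/= leq_add// leq_addr.
pose kappa n := (\max_(k < n.+1 | (S k <= n)%N) k)%N.
have kappaP m n : (S m <= n)%N -> (m <= kappa n)%N.
  move=> Smn; have mn : (m < n.+1)%N by rewrite ltnS (leq_trans (kS m)).
  exact: (@leq_bigmax_cond _ (fun k : 'I_n.+1 => (S k <= n)%N)
    (fun k : 'I_n.+1 => k : nat) (Ordinal mn)).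
exists kappa; split => [m|].
  by exists (S m) => // n /= /kappaP.
exists (S 0%N) => // n /= S0n; apply: NP; apply: leq_trans (SN _) _.
rewrite /kappa.
have [|k Sk ->] := @eq_bigmax_cond _ [pred k : 'I_n.+1 | (S k <= n)%N]
    (fun k : 'I_n.+1 => k : nat); last by [].
by apply/card_gt0P; exists ord0.
Qed.

Lemma filter_forall_lt (T : Type) (F : set_system T) {FF : Filter F} m
    (A : nat -> set T) : (forall i, (i < m)%N -> F (A i)) ->
  F [set t | forall i, (i < m)%N -> A i t].
Proof.
elim: m => [_|m IH FA]; first by apply: filterE => t i.
have Fm := FA m (ltnSn m).
have FI := IH (fun i im => FA i (ltn_trans im (ltnSn m))).
apply: filterS2 Fm FI => t Am AI i; rewrite ltnS leq_eqVlt => /orP[/eqP -> //|].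
exact: AI.
Qed.

Lemma half_pow_lt (R : realType) (C e : R) : 0 <= C -> 0 < e -> exists m, C / 2 ^+ m < e.
Proof.
move=> C0 e0; have C1 : 0 < C + 1 by rewrite ltr_wpDl.
have [|m] := @ltr_add_invr R 0 (e / (C + 1)); first by rewrite divr_gt0.
rewrite add0r => me; exists m; rewrite ltr_pdivrMr ?exprn_gt0//.
have m2 : m.+1%:R <= 2 ^+ m :> R by rewrite -natrX ler_nat ltn_expl.
have le2 : e / (C + 1) * m.+1%:R <= e / (C + 1) * 2 ^+ m.
  by rewrite ler_wpM2l// ltW// divr_gt0.
have : 1 < e / (C + 1) * m.+1%:R by rewrite -ltr_pdivrMr// mul1r.
move=> /lt_le_trans/(_ le2).
rewrite mulrAC ltr_pdivlMr// mul1r; lra.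
Qed.

Section ultrafilter_limits.
Context {T : Type} {R : realType}.
Implicit Types (U : set_system T) (g h : T -> R).

Definition ulim U g : R := lim (g @ U).

(** A bounded function takes its values in a compact segment, and the image of an ultrafilter
    converges to any of its cluster points. *)
Lemma ulim_cvg U {UU : UltraFilter U} g :
  bounded_on [set: T] g -> g @ U --> ulim U g.
Proof.
move=> [M gM].
have /(_ (g @ U) _)[|p [_ pcl]] := @segment_compact R (- M) M.
  by apply: (@filterE _ U) => t /=; rewrite in_itv/= -ler_norml; exact: gM.
apply: (cvgP p) => A /= Ap; have [//|UnA] := in_ultra_setVsetC (g @^-1` A) UU.
by have [x []] := pcl (~` A) A UnA Ap.
Qed.

Lemma ulim_dist U {UU : UltraFilter U} g (c e : R) : bounded_on [set: T] g ->
  U [set t | `|g t - c| <= e] -> `|ulim U g - c| <= e.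
Proof.
move=> bg Ug; have gU : g @ U --> ulim U g by exact: ulim_cvg.
exact: cvgr_to_le (cvg_norm (cvgB gU (cvg_cst c))) Ug.
Qed.

Lemma ulim_eq U {UU : UltraFilter U} g (c : R) : bounded_on [set: T] g ->
  U [set t | g t = c] -> ulim U g = c.
Proof.
move=> bg Ug; have : `|ulim U g - c| <= 0.
  by apply: ulim_dist => //; apply: filterS Ug => t /= ->; rewrite subrr normr0.
by rewrite normr_le0 subr_eq0 => /eqP.
Qed.

Lemma ulim_norm_le U {UU : UltraFilter U} g (e : R) :
  (forall t, `|g t| <= e) -> `|ulim U g| <= e.
Proof.
move=> ge; rewrite -[ulim U g]subr0; apply: ulim_dist; first by exists e.
by apply: filterE => t /=; rewrite subr0.
Qed.

Lemma bounded_on_linear g h (a : R) : bounded_on [set: T] g ->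
  bounded_on [set: T] h -> bounded_on [set: T] (fun t => a * g t + h t).
Proof.
move=> [M gM] [N hN]; exists (`|a| * M + N) => t _.
by rewrite (le_trans (ler_normD _ _))// normrM lerD ?ler_wpM2l ?gM ?hN.
Qed.

Lemma bounded_on_pred (P : pred T) :
  bounded_on [set: T] (fun t => (P t)%:R : R).
Proof. by exists 1 => t _; case: (P t); rewrite ?normr1 ?normr0. Qed.

Lemma ulim_linear U {UU : UltraFilter U} g h (a : R) : bounded_on [set: T] g ->
  bounded_on [set: T] h ->
  ulim U (fun t => a * g t + h t) = a * ulim U g + ulim U h.
Proof.
move=> bg bh; apply: cvg_lim => //.
have gU : g @ U --> ulim U g by exact: ulim_cvg.
have hU : h @ U --> ulim U h by exact: ulim_cvg.
exact: cvgD (cvgMl_tmp gU) hU.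
Qed.

End ultrafilter_limits.

(** The subspace is the range of [f], which need not be injective. Partial extensions are encoded as
    graphs, linear sets of pairs lying below [p]; such a graph is automatically single-valued
    because [p 0 = 0]. *)
Lemma hahn_banach (R : realType) (V W : lmodType R) (p : V -> R)
    (f : {linear W -> V}) (g : {linear W -> R^o}) :
  (forall x y, p (x + y) <= p x + p y) ->
  (forall (a : R) x, 0 <= a -> p (a *: x) = a * p x) ->
  (forall w, g w <= p (f w)) ->
  exists F : {linear V -> R^o}, (forall w, F (f w) = g w) /\ forall x, F x <= p x.
Proof.
move=> pD pZ gp.
have p0 : p 0 = 0 by rewrite -[0 in LHS](scale0r 0) pZ// mul0r.
pose G0 := [set (f w, g w : R) | w in setT].
pose lin (G : set (V * R)) := (forall u, G u -> u.2 <= p u.1) /\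
  forall (a : R) u v, G u -> G v -> G (a *: u.1 + v.1, a * u.2 + v.2).
have lin0 : lin G0.
  split=> [_ [w _ <-]|a _ _ [v _ <-] [w _ <-]]; first exact: gp.
  by exists (a *: v + w) => //; rewrite !linearP.
(* Adding [G0] inside the predicate makes the empty chain harmless. *)
have [|A [linA Amax]] := @Zorn_bigcup _ (fun G => lin (G `|` G0)).
  move=> F Flin Ftot; split=> [u [[G FG Gu]|G0u]|a u v].
  - by have [+ _] := Flin _ FG; apply; left.
  - by have [+ _] := lin0; apply.
  - move=> [[G FG Gu]|G0u] [[H FH Hv]|G0v].
    + have [GH|HG] := Ftot _ _ FG FH.
      * by have [_ /(_ a u v)[|||]] := Flin _ FH; [left; exact: GH|left|left; exists H|right].
      * by have [_ /(_ a u v)[|||]] := Flin _ FG; [left|left; exact: HG|left; exists G|right].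
    + by have [_ /(_ a u v)[|||]] := Flin _ FG; [left|right|left; exists G|right].
    + by have [_ /(_ a u v)[|||]] := Flin _ FH; [right|left|left; exists H|right].
    + by right; have [_] := lin0; apply.
pose G := A `|` G0; have [Gp Glin] : lin G := linA.
have G00 : G (0, 0) by right; exists 0; rewrite // !linear0.
have GZ a u : G u -> G (a *: u.1, a * u.2).
  by move=> Gu; have := Glin a _ _ Gu G00; rewrite /= !addr0.
(* For [x] outside of the domain, a value [r] is admissible when [u.2 - p (u.1 - x) <= r <= p (v.1 +
   x) - v.2] on the graph; the supremum of the left-hand sides is such a value. *)
have Gtot x : exists r, G (x, r).
  apply: contrapT => nGx.
  pose B := [set u.2 - p (u.1 - x) | u in G].
  have Bub v : G v -> ubound B (p (v.1 + x) - v.2).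
    move=> Gv _ [u Gu <-].
    have /Gp/= := Glin 1 _ _ Gu Gv; rewrite scale1r mul1r.
    have := pD (u.1 - x) (v.1 + x); rewrite addrACA addNr addr0.
    lra.
  have hsB : has_sup B.
    split; first by exists (0 - p (0 - x)), (0, 0).
    by exists (p (0 + x) - 0); exact: Bub G00.
  pose r := sup B.
  pose H := [set z | exists a u, G u /\ z = (u.1 + a *: x, u.2 + a * r)].
  have GH : G `<=` H.
    by move=> u Gu; exists 0, u; rewrite scale0r mul0r !addr0; case: u Gu.
  apply: (Amax H).
    split=> [u Au|HA]; first by apply: GH; left.
    apply: nGx; exists r; left; apply: HA.
    by exists 1, (0, 0); rewrite scale1r mul1r !add0r.
  have -> : H `|` G0 = H.
    by apply/setUidPl => u G0u; apply: GH; right.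
  split=> [_ [a [u [Gu ->]]]/=|b _ _ [a [u [Gu ->]]] [c [v [Gv ->]]]/=].
    (* After division by the absolute value of [a], a negative [a] uses that [r] is an upper bound
       of [B], a positive one that it is the least. *)
    have [a0|a0|->] := ltgtP a 0; last by rewrite scale0r mul0r !addr0; exact: Gp.
    - have : (- a)^-1 * u.2 - p ((- a)^-1 *: u.1 - x) <= r.
        apply: ub_le_sup; first by case: hsB.
        by exists ((- a)^-1 *: u.1, (- a)^-1 * u.2) => //; exact: GZ.
      have Na0 : 0 < - a by rewrite oppr_gt0.
      rewrite -(ler_pM2l Na0) mulrBr mulrA divff ?gt_eqF// mul1r.
      rewrite -pZ ?(ltW Na0)// scalerBr scalerA divff ?gt_eqF// scale1r scaleNr opprK.
      by rewrite lerBlDr mulNr => ?; lra.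
    - have /ge_sup : ubound B (p (a^-1 *: u.1 + x) - a^-1 * u.2).
        by apply: (Bub (a^-1 *: u.1, a^-1 * u.2)); exact: GZ.
      move=> /(_ hsB.1); rewrite -/r -(ler_pM2l a0) mulrBr mulrA divff ?gt_eqF// mul1r.
      rewrite -pZ ?(ltW a0)// scalerDr scalerA divff ?gt_eqF// scale1r => ?; lra.
  exists (b * a + c), (b *: u.1 + v.1, b * u.2 + v.2); split; first exact: Glin.
  congr pair; first by rewrite /= scalerDr scalerDl scalerA addrACA.
  by rewrite /= mulrDr mulrDl mulrA addrACA.
have Gfun x r s : G (x, r) -> G (x, s) -> r = s.
  have le r' s' : G (x, r') -> G (x, s') -> r' <= s'.
    move=> Gr Gs; have /Gp/= := Glin (- 1) _ _ Gs Gr.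
    by rewrite scaleN1r addNr p0 mulN1r addrC subr_le0.
  by move=> Gr Gs; apply/eqP; rewrite eq_le !le.
have [F GF] := choice Gtot.
have linF : linear (F : V -> R^o).
  move=> a x y; apply: Gfun (GF _) _.
  exact: Glin (GF x) (GF y).
pose FL : {linear V -> R^o} := HB.pack (F : V -> R^o)
  (GRing.isLinear.Build _ _ _ _ (F : V -> R^o) linF).
exists FL; split=> [w|x]; last exact: Gp (GF x).
by apply: Gfun (GF _) _; right; exists w.
Qed.

(** * Bounded finitely additive measures *)

Section bounded_functions.
Context (T : Type) (R : realType).

Definition bounded_pred : {pred T -> R} := fun f => `[< bounded_on [set: T] f >].

Lemma bounded_pred_submod_closed : submod_closed bounded_pred.
Proof.
split=> [|a g h]; first by apply/asboolP; exists 0 => t _; rewrite normr0.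
by move=> /asboolP bg /asboolP bh; apply/asboolP; exact: bounded_on_linear.
Qed.

HB.instance Definition _ := GRing.isSubmodClosed.Build R (T -> R)
  bounded_pred (GRing.submod_closed_semi bounded_pred_submod_closed).

Definition bfun := {f : T -> R | f \in bounded_pred}.

HB.instance Definition _ := SubChoice.on bfun.
HB.instance Definition _ := [SubChoice_isSubLmodule of bfun by <:].

Lemma bfun_bounded (f : bfun) : bounded_on [set: T] (val f).
Proof. exact/asboolP/(valP f). Qed.

Definition to_bfun (g : T -> R) (bg : bounded_on [set: T] g) : bfun :=
  Sub g (asboolT bg).

End bounded_functions.

(* A bounded finitely additive signed measure on all subsets of [T], seen as a
   functional; nothing is required of its values at unbounded functions. *)
Definition charge_le {T : Type} {R : realType} (M : R) (phi : (T -> R) -> R) :=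
  (forall (a : R) (g h : T -> R), bounded_on [set: T] g -> bounded_on [set: T] h ->
    phi (fun t => a * g t + h t) = a * phi g + phi h) /\
  forall (g : T -> R) (B : R), 0 <= B -> (forall t, `|g t| <= B) -> `|phi g| <= M * B.

Section charges.
Context {T : Type} {R : realType}.
Implicit Types (g h : T -> R) (phi : (T -> R) -> R).

(** Hahn-Banach for [M] times the sup norm on bounded functions; the domination makes [S] factor
    through [e]. *)
Lemma charge_extension (W : lmodType R) (e : W -> T -> R) (S : W -> R) (M : R) :
  0 <= M -> (forall w, bounded_on [set: T] (e w)) ->
  (forall a v w t, e (a *: v + w) t = a * e v t + e w t) ->
  (forall a v w, S (a *: v + w) = a * S v + S w) ->
  (forall w, `|S w| <= M * sup_norm [set: T] (e w)) ->
  exists phi, charge_le M phi /\ forall w, phi (e w) = S w.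
Proof.
move=> M0 be elin Slin SM.
pose E w : bfun T R := to_bfun (be w).
have Elin : linear E.
  by move=> a v w; apply/val_inj/funext => t; exact: elin.
have Slin' : linear (S : W -> R^o) by [].
pose EL : {linear W -> bfun T R} := HB.pack E
  (GRing.isLinear.Build _ _ _ _ E Elin).
pose SL : {linear W -> R^o} := HB.pack (S : W -> R^o)
  (GRing.isLinear.Build _ _ _ _ (S : W -> R^o) Slin').
pose p (f : bfun T R) : R := M * sup_norm [set: T] (val f).
have [| | |F [FE Fp]] := @hahn_banach R _ _ p EL SL.
- by move=> f h; rewrite -mulrDr ler_wpM2l// sup_normD//; exact: bfun_bounded.
- move=> a f a0; rewrite /p mulrCA [val _]/(a *: val f) sup_normZ ?ger0_norm//.
  exact: bfun_bounded.
- by move=> w; exact: le_trans (ler_norm _) (SM w).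
(* [phi] is made total by the value [0] at unbounded functions, on which [charge_le] puts no
   condition. *)
pose phi g := if pselect (bounded_on [set: T] g) is left bg then F (to_bfun bg)
  else 0.
have phiE g (bg : bounded_on [set: T] g) : phi g = F (to_bfun bg).
  by rewrite /phi; case: pselect => // bg'; congr (F _); exact: val_inj.
exists phi; split=> [|w]; last first.
  by rewrite (phiE _ (be w)); exact: FE.
split=> [a g h bg bh|g B B0 gB].
  rewrite (phiE _ bg) (phiE _ bh) (phiE _ (bounded_on_linear a bg bh)).
  by rewrite -[RHS](linearP F); congr (F _); exact: val_inj.
have bg : bounded_on [set: T] g by exists B => t _; exact: gB.
have le f : (forall t, `|val f t| <= B) -> F f <= M * B.
  by move=> fB; rewrite (le_trans (Fp f))// ler_wpM2l// sup_norm_le.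
rewrite (phiE _ bg) ler_norml lerNl -[- F _]linearN !le// => t.
by rewrite (_ : `|_| = `|g t|)//; exact: normrN.
Qed.

Context {M : R} {phi} (phiM : charge_le M phi).

Lemma charge0 : phi (fun=> 0) = 0.
Proof.
apply/eqP; rewrite -normr_le0 -[leRHS](mulr0 M); by apply: phiM.2 => // t; rewrite normr0.
Qed.

Lemma chargeD g h : bounded_on [set: T] g -> bounded_on [set: T] h ->
  phi (fun t => g t + h t) = phi g + phi h.
Proof.
move=> bg bh; have := phiM.1 1 g h bg bh; rewrite mul1r => <-.
by congr phi; apply/funext => t; rewrite mul1r.
Qed.

Lemma chargeZ a g : bounded_on [set: T] g -> phi (fun t => a * g t) = a * phi g.
Proof.
move=> bg; have := phiM.1 a g (fun=> 0) bg; rewrite charge0 addr0 => <-.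
  by congr phi; apply/funext => t; rewrite addr0.
by exists 0 => t _; rewrite normr0.
Qed.

Lemma chargeB g h : bounded_on [set: T] g -> bounded_on [set: T] h ->
  phi (fun t => g t - h t) = phi g - phi h.
Proof.
move=> bg bh; have := phiM.1 (- 1) h g bh bg; rewrite mulN1r addrC => <-.
by congr phi; apply/funext => t; rewrite mulN1r addrC.
Qed.

Lemma bounded_on_sum k (F : nat -> T -> R) :
  (forall j, (j < k)%N -> bounded_on [set: T] (F j)) ->
  bounded_on [set: T] (fun t => \sum_(j < k) F j t).
Proof.
elim: k => [_|k IH bF]; first by exists 0 => t _; rewrite big_ord0 normr0.
have [|B FB] := IH; first by move=> j jk; apply: bF; rewrite (leq_trans jk).
have [C FC] := bF k (ltnSn k); exists (B + C) => t _.
by rewrite big_ord_recr/= (le_trans (ler_normD _ _))// lerD ?FB ?FC.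
Qed.

Lemma charge_sum k (F : nat -> T -> R) :
  (forall j, (j < k)%N -> bounded_on [set: T] (F j)) ->
  phi (fun t => \sum_(j < k) F j t) = \sum_(j < k) phi (F j).
Proof.
elim: k => [_|k IH bF].
  by rewrite big_ord0 -[RHS]charge0; congr phi; apply/funext => t; rewrite big_ord0.
have bF' j : (j < k)%N -> bounded_on [set: T] (F j).
  by move=> jk; apply: bF; rewrite (leq_trans jk).
rewrite big_ord_recr/= -IH// -chargeD; [|exact: bounded_on_sum|exact: bF].
by congr phi; apply/funext => t; rewrite big_ord_recr.
Qed.

End charges.

(** * Extensions of null sequences that vanish in the limit at countably many test functions *)

Section weak_star_limits.
Context {T : Type} {R : realType}.

(* Veech's argument for Sobczyk's theorem: a weak* cluster point of bounded
   extensions of [S_n] vanishes on the subspace, so it may be subtracted. *)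
Lemma null_charge_extension (W : lmodType R) (e : W -> T -> R)
    (S : nat -> W -> R) (M : R) (z : nat -> T -> R) :
  0 <= M -> (forall w, bounded_on [set: T] (e w)) ->
  (forall a v w t, e (a *: v + w) t = a * e v t + e w t) ->
  (forall n a v w, S n (a *: v + w) = a * S n v + S n w) ->
  (forall n w, `|S n w| <= M * sup_norm [set: T] (e w)) ->
  (forall w, S ^~ w @ \oo --> 0) ->
  (forall i, bounded_on [set: T] (z i)) ->
  exists phi : nat -> (T -> R) -> R, [/\ forall n, charge_le (2 * M) (phi n),
    forall n w, phi n (e w) = S n w &
    forall i, phi ^~ (z i) @ \oo --> 0].
Proof.
move=> M0 be elin Slin SM S0 bz.
pose ext n phi := charge_le (2 * M) phi /\ forall w, phi (e w) = S n w.
have /choice[phi phiP] n := charge_extension M0 be elin (Slin n) (SM n).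
(* Otherwise an ultrafilter [U] lives on the bad indices. The limit [psi] of the [phi n] along [U]
   vanishes on the range of [e], since [S n w] tends to [0]; so [phi n - psi] still extends [S n],
   with bound [2 * M], and it is small at the first [m] test functions for [U]-many [n]. *)
have ext_near m : \forall n \near \oo, exists psi, ext n psi /\
    forall i, (i < m)%N -> `|psi (z i)| <= m.+1%:R^-1.
  set P := (X in \forall n \near \oo, X n).
  apply: contrapT => nP.
  have PF : ProperFilter (within (~` P) \oo).
    apply: Build_ProperFilter => - within0; apply: nP.
    have : \forall n \near \oo, ~ P n -> False := within0.
    apply: filterS => n nPn; by apply: contrapT => /nPn.
  have [U [UU UP]] := ultraFilterLemma PF.
  have U_oo A : (\forall n \near \oo, A n) -> U A.
    by move=> Ainf; apply: UP; exact: (cvg_within _ Ainf).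
  have UnP : U (~` P) by apply: UP; exact: withinT.
  have bphi g : bounded_on [set: T] g -> bounded_on [set: nat] (phi ^~ g).
    move=> [B gB]; exists (M * Num.max 0 B) => n _; apply: (phiP n).1.2.
      by rewrite le_max lexx.
    by move=> t; rewrite le_max gB ?orbT.
  pose psi g := ulim U (phi ^~ g).
  have psiM : charge_le M psi.
    split=> [a g h bg bh|g B B0 gB].
      rewrite -ulim_linear; [|exact: bphi|exact: bphi].
      by congr (ulim U _); apply/funext => n; exact: (phiP n).1.1.
    by apply: ulim_norm_le => n; exact: (phiP n).1.2.
  have psie w : psi (e w) = 0.
    apply: cvg_lim => // A /(S0 w) SA.
    suff : U [set n | A (phi n (e w))] by [].
    by apply: filterS (U_oo _ SA) => n /=; rewrite (phiP n).2.
  have : U P.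
    have Uz i : U [set n | `|phi n (z i) - psi (z i)| <= m.+1%:R^-1].
      have /cvgrPdist_le : phi ^~ (z i) @ U --> psi (z i).
        by apply: ulim_cvg; exact: bphi.
      by move=> /(_ m.+1%:R^-1); rewrite invr_gt0 ltr0n => /(_ isT);
        apply: filterS => n; rewrite distrC.
    have Uzm : U [set n | forall i, (i < m)%N ->
        `|phi n (z i) - psi (z i)| <= m.+1%:R^-1].
      by apply: filter_forall_lt => i _; exact: Uz.
    apply: filterS Uzm => n /= nz.
    exists (fun g => phi n g - psi g); split; last exact: nz.
    split=> [|w]; last by rewrite psie subr0 (phiP n).2.
    split=> [a g h bg bh|g B B0 gB].
      by rewrite (phiP n).1.1// psiM.1// mulrBr opprD addrACA.
    rewrite (le_trans (ler_normB _ _))// mulr_natl mulr2n mulrDl.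
    by rewrite lerD//; [exact: (phiP n).1.2|exact: psiM.2].
  move=> UPP; have UPnP : U (P `&` ~` P) by exact: filterI.
  by have [n []] := filter_ex UPnP.
have [kappa [kappa_oo kappaP]] := nat_diagonal ext_near.
have [N _ NP] := kappaP.
(* The indices before [N] keep [phi n]; the others follow the diagonal choice, whose accuracy
   improves with [kappa n]. *)
have /choice[psi psiP] n : exists psi, ext n psi /\ ((N <= n)%N ->
    forall i, (i < kappa n)%N -> `|psi (z i)| <= (kappa n).+1%:R^-1).
  have [Nn|nN] := leqP N n; first by have [psi [? ?]] := NP n Nn; exists psi.
  exists (phi n); split=> //; split; last exact: (phiP n).2.
  split; first exact: (phiP n).1.1.
  move=> g B B0 gB; rewrite (le_trans ((phiP n).1.2 _ _ B0 gB))//.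
  by rewrite ler_wpM2r// ler_peMl// ler1n.
exists psi; split=> [n|n w|i]; [exact: (psiP n).1.1|exact: (psiP n).1.2|].
apply/cvgr0Pnorm_le => eps eps0.
have [m] := ltr_add_invr eps0; rewrite add0r => mP.
near=> n; have := (psiP n).2 _ i.
have nN : (N <= n)%N by near: n; exists N.
have ni : (i < kappa n)%N by near: n; exact: kappa_oo i.+1.
have nm : (m <= kappa n)%N by near: n; exact: kappa_oo m.
move=> /(_ nN ni) /le_trans; apply; rewrite (le_trans _ (ltW mP))//.
by rewrite lef_pV2 ?posrE// ler_nat ltnS.
Unshelve. all: by end_near. Qed.

End weak_star_limits.

(** * Step functions on compact lines *)

Section pattern.
Context {d : Order.disp_t} {K : orderType d} {R : realType}.
Implicit Types (l : seq K) (u v : K).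

(** The classes are the cells into which [l] cuts the line, half-open and closed on the right. *)
Definition same_side l u v := forall t, t \in l -> (u <= t)%O = (v <= t)%O.

Lemma same_sideS l1 l2 u v : {subset l1 <= l2} -> same_side l2 u v ->
  same_side l1 u v.
Proof. by move=> l12 s t /l12; exact: s. Qed.

Lemma same_side_sym l u v : same_side l u v -> same_side l v u.
Proof. by move=> s t /s. Qed.

Lemma same_side_trans l u v w : same_side l u v -> same_side l v w ->
  same_side l u w.
Proof. by move=> uv vw t tl; rewrite uv// vw. Qed.

(** The oscillation on each cell is at most [e], so [f] is within [e] of a step function with jumps
    in [l]. *)
Definition fine l (f : K -> R) (e : R) :=
  forall u v, same_side l u v -> `|f u - f v| <= e.

End pattern.

Section compact_line.
Context {d : Order.disp_t} {K : compactLineType d} {R : realType}.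
Implicit Types (l : seq K) (t u v x : K).

Lemma near_covering_line (I : Type) (F : set_system I) (P : I -> K -> Prop) :
  Filter F ->
  (forall x, \forall x' \near x & i \near F, P i x') ->
  \forall i \near F, forall x, P i x.
Proof.
move=> FF Px; have cK : near_covering [set: K].
  by apply/compact_near_coveringP; exact: compact_setT.
by apply: filterS (cK I F P FF (fun x _ => Px x)) => i Pi x; exact: Pi.
Qed.

(** A cluster point of the filter of initial segments is a least element: were it above some [t],
    the open ray beyond [t] would be a neighbourhood missing a segment. *)
Lemma line_bottom : exists m : K, forall t, (m <= t)%O.
Proof.
pose F := filter_from [set: K] (fun t => [set u | (u <= t)%O]).
have [t0 _] := @nonempty_setT K.
have FF : ProperFilter F.
  apply: filter_from_proper; last by move=> t _; exists t => /=.
  apply: filter_from_filter; first by exists t0.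
  move=> s t _ _; exists (Order.min s t) => // u /=.
  by rewrite le_min => /andP[].
have [|m [_ mF]] := @compact_setT K F FF; first by exists t0.
exists m => t; rewrite leNgt; apply/negP => tm.
have [||u []/=] := mF [set u | (u <= t)%O] [set` `]t, +oo[] _ _.
- by exists t.
- by apply: open_nbhs_nbhs; split; [exact: rray_open|rewrite /= in_itv/= tm].
- by rewrite in_itv/= andbT leNgt => /negP.
Qed.

Lemma line_top : exists m : K, forall t, (t <= m)%O.
Proof.
pose F := filter_from [set: K] (fun t => [set u | (t <= u)%O]).
have [t0 _] := @nonempty_setT K.
have FF : ProperFilter F.
  apply: filter_from_proper; last by move=> t _; exists t => /=.
  apply: filter_from_filter; first by exists t0.
  move=> s t _ _; exists (Order.max s t) => // u /=.
  by rewrite ge_max => /andP[].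
have [|m [_ mF]] := @compact_setT K F FF; first by exists t0.
exists m => t; rewrite leNgt; apply/negP => mt.
have [||u []/=] := mF [set u | (t <= u)%O] [set` `]-oo, t[] _ _.
- by exists t.
- by apply: open_nbhs_nbhs; split; [exact: lray_open|rewrite /= in_itv/= mt].
- by rewrite in_itv/= leNgt => /negP.
Qed.

(** The cell around [x] must itself be a neighbourhood of [x]. Its left end is an open condition;
    only the closed right end needs a choice. *)
Lemma nbhs_same_side x (A : set K) : nbhs x A ->
  exists l, nbhs x [set u | same_side l x u] /\ [set u | same_side l x u] `<=` A.
Proof.
move=> xA; have [[a b] /= [ab xab] abA] :
    exists2 i, itv_open_ends i /\ x \in i & [set` i] `<=` A.
  by move: xA; rewrite itv_nbhsE.
have [l1 [nl1 l1P]] : exists l, nbhs x [set u | same_side l x u] /\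
    forall u, same_side l x u -> (a <= BLeft u)%O.
  move: ab xab; rewrite /itv_open_ends; case: a {abA} => [[|] a|[|]].
  - by case: b => [[|] b|[|]].
  - move=> _; rewrite itv_boundlr => /andP[+ _].
    rewrite bnd_simp => ax; exists [:: a]; split => [|u /(_ a)].
      apply: filterS (open_nbhs_nbhs (conj (rray_open a) _)) => /=; last first.
        by rewrite in_itv/= ax.
      move=> u /=; rewrite in_itv/= andbT => au t.
      by rewrite inE => /eqP ->; rewrite !leNgt ax au.
    by rewrite inE eqxx bnd_simp ltNge => <-//; rewrite -ltNge.
  - by move=> _ _; exists [::]; split=> //; exact: filterE.
  - by rewrite itv_boundlr.
have [l2 [nl2 l2P]] : exists l, nbhs x [set u | same_side l x u] /\
    forall u, same_side l x u -> (BRight u <= b)%O.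
  move: ab xab; rewrite /itv_open_ends; case: b {abA} => [[|] b|[|]].
  - move=> _; rewrite itv_boundlr => /andP[_].
    rewrite bnd_simp => xb.
    (* Any [c] strictly between [x] and [b] serves. If there is none, [b] is the successor of [x],
       and [c = x] works because [u <= x] then means [u < b]. *)
    have [c [xc cb cn]] : exists c, [/\ (x <= c)%O, (c < b)%O & nbhs x [set u | (u <= c)%O]].
      have [[c /andP[xc cb]]|noc] := pselect (exists c, (x < c < b)%O).
        exists c; split=> //; first exact: ltW.
        apply: filterS (open_nbhs_nbhs (conj (lray_open c) _)) => /=; last first.
          by rewrite in_itv/= xc.
        by move=> u /=; rewrite in_itv/=; exact: ltW.
      exists x; split=> //.
      apply: filterS (open_nbhs_nbhs (conj (lray_open b) _)) => /=; last first.
        by rewrite in_itv/= xb.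
      move=> u /=; rewrite in_itv/= => ub; rewrite leNgt; apply/negP => xu.
      by apply: noc; exists u; rewrite xu.
    exists [:: c]; split => [|u /(_ c)].
      by apply: filterS cn => u uc t; rewrite inE => /eqP ->; rewrite xc uc.
    by rewrite inE eqxx bnd_simp xc => /(_ isT) /esym uc; exact: le_lt_trans cb.
  - by case: a {l1P} => [[|] a|[|]].
  - by rewrite itv_boundlr => _ /andP[_].
  - by move=> _ _; exists [::]; split=> //; exact: filterE.
exists (l1 ++ l2); split.
  apply: filterS (filterI nl1 nl2) => u [u1 u2] t.
  by rewrite mem_cat => /orP[/u1//|/u2//].
move=> u xu; apply: abA; rewrite /= itv_boundlr l1P ?l2P//.
  by apply: same_sideS xu => t; rewrite mem_cat => ->; rewrite orbT.
by apply: same_sideS xu => t; rewrite mem_cat => ->.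
Qed.

Lemma continuous_fine (f : K -> R) (e : R) : continuous f -> 0 < e ->
  exists l, fine l f e.
Proof.
move=> cf e0.
(* Finite lists are directed by inclusion, and compactness turns the local lists into a single
   one. *)
pose F := filter_from [set: seq K] (fun l => [set l' : seq K | {subset l <= l'}]).
have FF : ProperFilter F.
  apply: filter_from_proper; last by move=> l _; exists l => t.
  apply: filter_from_filter; first by exists [::].
  move=> l1 l2 _ _; exists (l1 ++ l2) => // l l12.
  by split=> t tl; apply: l12; rewrite mem_cat tl ?orbT.
suff : \forall l \near F, forall u v, same_side l u v -> `|f u - f v| <= e.
  by move=> /filter_ex[l]; exists l.
apply: near_covering_line => x.
have /nbhs_same_side[l [nl lP]] : nbhs x [set u | `|f x - f u| <= e / 2].
  by have /cvgrPdist_le := cf x; apply; rewrite divr_gt0.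
exists ([set u | same_side l x u], [set l' : seq K | {subset l <= l'}]).
  by split=> //; exists l.
move=> [u l'] /= [xu ll'] v /(same_sideS ll') uv.
rewrite [e]splitr -(subrK (f x) (f u)) -addrA (le_trans (ler_normD _ _))// lerD//.
  by rewrite distrC; exact: lP.
by apply: lP; exact: same_side_trans xu uv.
Qed.

(** [c] enumerates cuts that make each [x i] fine to each accuracy [m.+1%:R^-1]. For [f] one uses
    compactness of the square: near a pair [(u, v)], either the two values of [f] stay less than [e]
    apart, or some [x i] tells the two points apart, and then so does a finite part of [c]. *)
Lemma countable_fine (x : nat -> K -> R) : (forall i, continuous (x i)) ->
  exists c : nat -> K, [/\ exists i, forall t, (c i <= t)%O,
    exists i, forall t, (t <= c i)%O &
    forall (f : K -> R) (e : R), continuous f ->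
      (forall u v, (forall i, x i u = x i v) -> f u = f v) -> 0 < e ->
      exists k, fine (mkseq c k) f e].
Proof.
move=> cx; have [bot botP] := line_bottom; have [top topP] := line_top.
have /choice[l lP] (p : nat * nat) : exists l, fine l (x p.1) p.2.+1%:R^-1.
  by apply: continuous_fine => //; rewrite invr_gt0.
(* In a code [(p, j)], [j = 0] stands for the bottom, [j = 1] for the top, and [j.+2] for entry [j]
   of [l p]. *)
pose c n := if unpickle n is Some (p, j) then nth bot (bot :: top :: l p) j
  else bot.
have cP p j : c (pickle (p, j)) = nth bot (bot :: top :: l p) j.
  by rewrite /c pickleK.
exists c; split.
- by exists (pickle ((0, 0), 0))%N => t; rewrite cP.
- by exists (pickle ((0, 0), 1))%N => t; rewrite cP.
have lc p : exists k, {subset l p <= mkseq c k}.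
  exists (\max_(j < (size (l p)).+2) pickle (p, j : nat)).+1%N => t tl.
  have jl : ((index t (l p)).+2 < (size (l p)).+2)%N by rewrite !ltnS index_mem.
  apply/mapP; exists (pickle (p, (index t (l p)).+2)).
    rewrite mem_iota add0n leq0n ltnS.
    exact: (@leq_bigmax _ (fun j : 'I_(size (l p)).+2 => pickle (p, j : nat)) (Ordinal jl)).
  by rewrite cP /= nth_index.
move=> f e cf sepf e0.
suff : \forall k \near \oo, forall w : K * K,
    same_side (mkseq c k) w.1 w.2 -> `|f w.1 - f w.2| <= e.
  by move=> /filter_ex[k kP]; exists k => u v; exact: (kP (u, v)).
have /compact_near_coveringP KK : compact ([set: K] `*` [set: K]).
  by apply: compact_setX; exact: compact_setT.
have := KK _ \oo (fun k w => same_side (mkseq c k) w.1 w.2 -> `|f w.1 - f w.2| <= e).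
move=> /(_ _)[[u v] _|A Aoo AP]; last first.
  by exists A => // k Ak w; apply: AP.
have cvg_dist (g : K -> R) : continuous g ->
    (fun w : K * K => `|g w.1 - g w.2|) @ (u, v) --> `|g u - g v|.
  move=> cg.
  have cg1 : g \o fst @ (u, v) --> g u.
    move=> A /(cg u) uA; exists (g @^-1` A, setT) => [|[w1 w2] []//].
    by split=> //; exact: filterT.
  have cg2 : g \o snd @ (u, v) --> g v.
    move=> A /(cg v) vA; exists (setT, g @^-1` A) => [|[w1 w2] []//].
    by split=> //; exact: filterT.
  exact: (cvg_norm (cvgB cg1 cg2)).
have [fuv|fuv] := ltP `|f u - f v| e.
  exists ([set w | `|f w.1 - f w.2| < e], setT).
    by split; [exact: (cvgr_lt _ (cvg_dist f cf))|exact: filterT].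
  by move=> [w k] [/= /ltW].
have [i xuv] : exists i, x i u <> x i v.
  apply: contrapT => /forallNP xE; have fE : f u = f v.
    by apply: sepf => i; apply: contrapT; exact: xE.
  by move: fuv; rewrite fE subrr normr0 leNgt e0.
have [m] : exists m, 0 + m.+1%:R^-1 < `|x i u - x i v|.
  by apply: ltr_add_invr; rewrite normr_gt0 subr_eq0; apply/eqP.
rewrite add0r => mx; have [k0 lk0] := lc (i, m).
exists ([set w | m.+1%:R^-1 < `|x i w.1 - x i w.2|], [set k | (k0 <= k)%N]).
  by split; [exact: (cvgr_gt _ (cvg_dist _ (cx i)))|exists k0].
move=> [w k] [/= xw k0k] wk; exfalso; move: xw; rewrite ltNge => /negP; apply.
apply: (lP (i, m)); apply: same_sideS wk => t /lk0 /mapP[j jk ->].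
apply/mapP; exists j => //; move: jk; rewrite !mem_iota !add0n /=.
by move=> /leq_trans; apply.
Qed.

(* Such an [h] is a combination on [P] of indicators of initial segments. *)
Lemma charge_same_side_cvg0 (psi : nat -> (K -> R) -> R) (M : R) l (P : pred K)
    (h : K -> R) :
  (forall n, charge_le M (psi n)) ->
  (forall s, (fun n => psi n (fun t => (P t && (t <= s)%O)%:R)) @ \oo --> (0 : R)) ->
  (forall u v, P u -> P v -> same_side l u v -> h u = h v) ->
  bounded_on [set: K] h ->
  (fun n => psi n (fun t => (P t)%:R * h t)) @ \oo --> (0 : R).
Proof.
move=> psiM; have bind Q := @bounded_on_pred K R Q.
have bindM (Q : pred K) (g : K -> R) : bounded_on [set: K] g ->
    bounded_on [set: K] (fun t => (Q t)%:R * g t).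
  move=> [B gB]; exists (Num.max 0 B) => t _; rewrite le_max.
  by case: (Q t); rewrite ?mul1r ?mul0r ?normr0 ?lexx// gB// orbT.
elim: l P h => [|s l IH] P h PD hP bh.
  have [[u Pu]|nP] := pselect (exists u, P u); last first.
    rewrite (_ : (fun n => _) = fun=> 0); first exact: cvg_cst.
    apply/funext => n; rewrite -[RHS](charge0 (psiM n)); congr (psi n _).
    apply/funext => t; case Pt: (P t); last by rewrite mul0r.
    by exfalso; apply: nP; exists t.
  have [top topP] := line_top.
  rewrite (_ : (fun n => _) =
    fun n => h u * psi n (fun t => (P t && (t <= top)%O)%:R)); last first.
    apply/funext => n; rewrite -(chargeZ (psiM n))//; congr (psi n _).
    apply/funext => t; rewrite topP andbT; case Pt: (P t).
      by rewrite mulr1 mul1r; exact: hP.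
    by rewrite mulr0 mul0r.
  by rewrite -[0](mulr0 (h u)); exact: cvgMl_tmp.
(* Both halves inherit the hypothesis on initial segments: on [P1] the end [r] becomes the minimum
   of [s] and [r], and on [P2] one takes a difference. *)
pose P1 t := P t && (t <= s)%O; pose P2 t := P t && ~~ (t <= s)%O.
have P1D r : (fun n => psi n (fun t => (P1 t && (t <= r)%O)%:R)) @ \oo --> (0 : R).
  rewrite (_ : (fun n => _) =
    fun n => psi n (fun t => (P t && (t <= Order.min s r)%O)%:R)); first exact: PD.
  apply/funext => n; congr (psi n _); apply/funext => t.
  by rewrite /P1 -andbA le_min.
have P2D r : (fun n => psi n (fun t => (P2 t && (t <= r)%O)%:R)) @ \oo --> (0 : R).
  rewrite (_ : (fun n => _) = fun n => psi n (fun t => (P t && (t <= r)%O)%:R) -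
    psi n (fun t => (P1 t && (t <= r)%O)%:R)); last first.
    apply/funext => n; rewrite -(chargeB (psiM n))//; congr (psi n _).
    apply/funext => t; rewrite /P1 /P2.
    by case: (P t); case: (t <= s)%O; case: (t <= r)%O; rewrite ?subrr ?subr0.
  by rewrite -[0](subrr (0 : R)); exact: cvgB.
rewrite (_ : (fun n => _) = fun n => psi n (fun t => (P1 t)%:R * h t) +
    psi n (fun t => (P2 t)%:R * h t)); last first.
  apply/funext => n; rewrite -(chargeD (psiM n)); [|exact: bindM..].
  congr (psi n _); apply/funext => t; rewrite /P1 /P2 -mulrDl.
  by case: (P t); case: (t <= s)%O; rewrite ?addr0 ?add0r.
rewrite -[0](addr0 (0 : R)); apply: cvgD; apply: IH => //.
  move=> u v /andP[Pu us] /andP[Pv vs] uv; apply: hP => // t.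
  by rewrite inE => /orP[/eqP ->|/uv//]; rewrite us vs.
move=> u v /andP[Pu us] /andP[Pv vs] uv; apply: hP => // t.
by rewrite inE => /orP[/eqP ->|/uv//]; rewrite (negbTE us) (negbTE vs).
Qed.

(** A continuous function is uniformly close to one that is constant on the cells of a finite list,
    where the previous lemma applies; the common bound [M] controls the error. *)
Lemma charge_continuous_cvg0 (psi : nat -> (K -> R) -> R) (M : R) (f : K -> R) :
  (forall n, charge_le M (psi n)) ->
  (forall s, (fun n => psi n (fun t => (t <= s)%O%:R)) @ \oo --> (0 : R)) ->
  continuous f -> bounded_on [set: K] f ->
  (fun n => psi n f) @ \oo --> (0 : R).
Proof.
move=> psiM psiD cf bf; have M0 : 0 <= M.
  by have := (psiM 0%N).2 (fun=> 0) 1 ler01; rewrite mulr1 normr0;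
    move=> /(_ (fun=> ler01)); exact: le_trans.
apply/cvgr0Pnorm_le => e e0.
(* Chosen so that [M * e' <= e / 2]; the [+ 1] keeps the denominator positive. *)
pose e' := e / 2 / (M + 1).
have M1 : 0 < M + 1 by rewrite ltr_wpDl.
have e'0 : 0 < e' by rewrite !divr_gt0.
have [l lf] := continuous_fine cf e'0.
pose h t := f (xget t [set u | same_side l t u]).
have hP t : same_side l t (xget t [set u | same_side l t u]).
  by case: xgetP => [w -> //|/(_ t) []].
have hE u v : same_side l u v -> h u = h v.
  move=> uv; have uvE : [set w | same_side l u w] = [set w | same_side l v w].
    apply/seteqP; split=> w /=; apply: same_side_trans => //.
    exact: same_side_sym.
  rewrite /h uvE; congr f; rewrite /xget; case: pselect => // -[].
  by exists v; apply/asboolP.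
have bh : bounded_on [set: K] h by have [B fB] := bf; exists B => t _; exact: fB.
have h0 : (fun n => psi n (fun t => (predT t)%:R * h t)) @ \oo --> (0 : R).
  by apply: (charge_same_side_cvg0 (l := l) psiM) => // u v _ _; exact: hE.
have /cvgr0Pnorm_le/(_ (e / 2)) := h0; rewrite divr_gt0// => /(_ isT).
apply: filterS => n; rewrite (_ : (fun t => _) = h); last first.
  by apply/funext => t; rewrite mul1r.
move=> hn; have -> : psi n f = (psi n f - psi n h) + psi n h by rewrite subrK.
rewrite (le_trans (ler_normD _ _))// [leRHS]splitr lerD//.
rewrite -(chargeB (psiM n))// (le_trans ((psiM n).2 _ e' (ltW e'0) _))//.
  by move=> t; exact: lf.
by rewrite /e' mulrCA ler_piMr ?divr_ge0 ?(ltW e0)// ler_pdivrMr// mul1r lerDl.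
Qed.

End compact_line.

(** * Half-open intervals and retractions *)

Section disjoint_intervals.
Context {d : Order.disp_t} {K : orderType d}.
Implicit Types (I J W : K * K) (L : seq (K * K)) (s t u : K).

Definition oc I : pred K := fun t => (I.1 < t <= I.2)%O.

(** Pieces may be empty. A [J] with [J.2 <= J.1] is skipped, since the pieces on its two sides could
    overlap. *)
Fixpoint oc_diff W L : seq (K * K) :=
  if L is J :: L' then
    if (J.1 < J.2)%O then
      oc_diff (W.1, Order.min W.2 J.1) L' ++ oc_diff (Order.max W.1 J.2, W.2) L'
    else oc_diff W L'
  else [:: W].

(** Counting expresses covering and disjointness of the pieces in one equation, which suits the
    induction. *)
Lemma count_oc_diff W L u :
  count (oc^~ u) (oc_diff W L) = oc W u && ~~ has (oc^~ u) L :> nat.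
Proof.
elim: L W => [|I L IH] W /=; first by rewrite andbT addn0.
have [I12|I21] := ltP I.1 I.2.
  rewrite count_cat !IH /oc /= le_min gt_max [(u <= I.1)%O]leNgt [(I.2 < u)%O]ltNge.
  have : (I.1 < u)%O || (u <= I.2)%O.
    by rewrite orbC; have [//|/= Iu] := leP u I.2; exact: lt_trans Iu.
  case: (W.1 < u)%O; case: (u <= W.2)%O; case: (I.1 < u)%O; case: (u <= I.2)%O;
    case: has => //.
rewrite IH (_ : oc I u = false)//; apply/negP => /andP[Iu uI].
by have := lt_le_trans Iu uI; rewrite ltNge I21.
Qed.

Lemma size_oc_diff W L : (0 < size (oc_diff W L))%N.
Proof.
elim: L W => //= I L IH W; case: ifP => // _.
by rewrite size_cat addn_gt0 IH.
Qed.

Lemma oc_diff_ind (P : K * K -> Prop) (C : set K) W L :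
  (forall I x y, P I -> C x -> C y -> (I.1 <= x)%O -> (y <= I.2)%O -> P (x, y)) ->
  (forall I, P I -> C I.1 /\ C I.2) ->
  P W -> (forall I, I \in L -> P I) -> forall I, I \in oc_diff W L -> P I.
Proof.
move=> Psub PC; elim: L W => [|J L IH] W PW PL I; first by rewrite inE => /eqP ->.
have PJ := PL J (mem_head _ _); have PL' I' : I' \in L -> P I'.
  by move=> I'L; apply: PL; rewrite inE I'L orbT.
rewrite /=; case: ifP => _; last exact: IH.
have [[W1 W2] [J1 J2]] := (PC _ PW, PC _ PJ).
rewrite mem_cat => /orP[]; apply: IH => //; apply: (Psub W) => //=.
- by rewrite minEle; case: ifP.
- by rewrite ge_min lexx.
- by rewrite maxEle; case: ifP.
- by rewrite le_max lexx.
Qed.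

Lemma count_le1_nth (T : Type) (p : pred T) x0 (s : seq T) i j :
  (count p s <= 1)%N -> (i < size s)%N -> (j < size s)%N ->
  p (nth x0 s i) -> p (nth x0 s j) -> i = j.
Proof.
elim: s i j => //= x s IH [|i] [|j] //=; rewrite !ltnS.
- case: (p x) => //=; rewrite add1n ltnS leqn0 => /eqP c0 _ js _ pj.
  have : has p s by apply/(has_nthP x0); exists j.
  by rewrite has_count c0.
- case: (p x) => //=; rewrite add1n ltnS leqn0 => /eqP c0 is_ _ pi _.
  have : has p s by apply/(has_nthP x0); exists i.
  by rewrite has_count c0.
- move=> c1 is_ js pi pj; congr S; apply: IH => //.
  by apply: leq_trans c1; exact: leq_addl.
Qed.

(** The pieces of [w k] not covered so far are appended to a list one [k] after another. Their ends
    come from intervals already in [P], which is why [P] is only asked to pass to subintervals with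
    ends in [C]. *)
Lemma disjoint_intervals (P : K * K -> Prop) (C : set K) (w : nat -> K * K) :
  (forall I x y, P I -> C x -> C y -> (I.1 <= x)%O -> (y <= I.2)%O -> P (x, y)) ->
  (forall I, P I -> C I.1 /\ C I.2) -> (forall k, P (w k)) ->
  exists B : nat -> K * K, [/\ forall j, P (B j),
    forall i j t, oc (B i) t -> oc (B j) t -> i = j &
    forall k, exists m, forall t, oc (w k) t -> exists2 j, (j < m)%N & oc (B j) t].
Proof.
move=> Psub PC Pw.
pose L := fix L k := if k is k'.+1 then L k' ++ oc_diff (w k') (L k') else [::].
have LP k I : I \in L k -> P I.
  elim: k I => //= k IH I; rewrite mem_cat => /orP[/IH//|].
  exact: (oc_diff_ind Psub PC).
have sizeL k : (k <= size (L k))%N.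
  elim: k => //= k IH; rewrite size_cat -addn1 leq_add//.
  exact: size_oc_diff.
have nthL k l j : (k <= l)%N -> (j < size (L k))%N ->
    (j < size (L l))%N /\ nth (w 0) (L l) j = nth (w 0) (L k) j.
  elim: l => [|l IH]; first by rewrite leqn0 => /eqP ->.
  rewrite leq_eqVlt => /orP[/eqP <- //|]; rewrite ltnS => kl jk.
  have [jl <-] := IH kl jk.
  by rewrite /= size_cat nth_cat jl ltn_addr.
have countL k u : (count (oc^~ u) (L k) <= 1)%N.
  elim: k => //= k IH; rewrite count_cat count_oc_diff has_count.
  by move: IH; case: (count _ _) => [|[|]] //=; rewrite ?andbT ?andbF; case: oc.
have jL j : (j < size (L j.+1))%N by exact: sizeL.
(* Each stage appends at least one piece, possibly empty, so entry [j] exists from stage [j.+1] on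
   and never changes. *)
exists (fun j => nth (w 0) (L j.+1) j); split=> [j|i j t|k].
- by apply: (LP j.+1); rewrite mem_nth.
- have [ij _] := nthL i.+1 (maxn i.+1 j.+1) i (leq_maxl _ _) (jL i).
  have [ji _] := nthL j.+1 (maxn i.+1 j.+1) j (leq_maxr _ _) (jL j).
  have [_ <-] := nthL i.+1 (maxn i.+1 j.+1) i (leq_maxl _ _) (jL i).
  have [_ <-] := nthL j.+1 (maxn i.+1 j.+1) j (leq_maxr _ _) (jL j).
  by move=> ti tj; apply: (count_le1_nth (countL _ t)) ti tj.
- exists (size (L k.+1)) => t wt.
  have : has (oc^~ t) (L k.+1).
    rewrite has_count /= count_cat count_oc_diff wt has_count.
    by case: (count _ _).
  move=> /(has_nthP (w 0))[j jk jt]; exists j => //.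
  have [_ E1] := nthL j.+1 (maxn j.+1 k.+1) j (leq_maxl _ _) (jL j).
  have [_ E2] := nthL k.+1 (maxn j.+1 k.+1) j (leq_maxr _ _) jk.
  by rewrite -E1 E2.
Qed.

End disjoint_intervals.

Section retraction.
Context {d : Order.disp_t} {K : orderType d}.
Context (a b : K) (V : nat -> set K).
Hypothesis Vab : V 0 `<=` oc (a, b).
Hypothesis Vdecr : forall i j, (i <= j)%N -> V j `<=` V i.
Hypothesis Vneq0 : forall j, V j !=set0.

(** No point of some [V j] separates [s] from [s']: the classes are the gaps, possibly trivial, that
    the [V j] leave in the limit. *)
Let sim s s' := exists j, forall u, V j u -> (u <= s)%O = (u <= s')%O.

Let simxx s : sim s s. Proof. by exists 0%N. Qed.

Let sim_sym s s' : sim s s' -> sim s' s.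
Proof. by move=> [j sj]; exists j => u /sj. Qed.

Let sim_trans s s' s'' : sim s s' -> sim s' s'' -> sim s s''.
Proof.
move=> [i si] [j sj]; exists (maxn i j) => u Vu; rewrite si ?sj//.
  exact: Vdecr (leq_maxr _ _) _ Vu.
exact: Vdecr (leq_maxl _ _) _ Vu.
Qed.

Let nsim_ab : ~ sim a b.
Proof.
move=> [j sj]; have [u Vu] := Vneq0 j; have := sj _ Vu.
have /andP[/= au ->] := Vab (Vdecr (leq0n j) Vu).
by rewrite leNgt au.
Qed.

(** A splitting point for each gap. The gaps of [a] and [b] are split at these ends, so that points
    of [V 0] in them are folded inwards. *)
Let rep s : K := if `[< sim s a >] then a else if `[< sim s b >] then b
  else xget a [set u | sim u s].

Let rep_sim s : sim (rep s) s.
Proof.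
rewrite /rep; case: asboolP => [/sim_sym//|_]; case: asboolP => [/sim_sym//|_].
case: xgetP => [u -> //|/(_ s) []]; exact: simxx.
Qed.

Let repE s s' : sim s s' -> rep s = rep s'.
Proof.
move=> ss'; have simE x : sim s x = sim s' x.
  by apply/propext; split; apply: sim_trans => //; exact: sim_sym.
rewrite /rep !simE; congr (if _ then _ else if _ then _ else xget a _).
apply/seteqP; split=> u /= us; apply: sim_trans us _ => //; exact: sim_sym.
Qed.

Let nsimP s s' j : (s < s')%O -> ~ sim s s' -> exists2 u, V j u & (s < u <= s')%O.
Proof.
move=> ss' nss'; apply: contrapT => nu; apply: nss'; exists j => u Vu.
have [us|su] := leP u s; first by rewrite (le_trans us (ltW ss')).
apply/esym/negP => us'; apply: nu; exists u => //.
by rewrite su.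
Qed.

(** This makes the filter base for folding to the left inhabited, with [a] as a first cut. *)
Let left_a t : V 0 t -> (t <= rep t)%O -> (a < t)%O /\ ~ sim a t.
Proof.
move=> Vt tr; have /andP[/= at_ _] := Vab Vt; split=> // /sim_sym ta.
by move: tr; rewrite /rep asboolT// leNgt at_.
Qed.

Let right_b t : V 0 t -> (rep t < t)%O -> (t < b)%O /\ ~ sim t b.
Proof.
move=> Vt tr; have /andP[/= _ tb] := Vab Vt.
have ntb : ~ sim t b.
  move=> tb'; move: tr; rewrite (repE tb') /rep.
  rewrite asboolF; last by move=> /sim_sym.
  by rewrite asboolT// ltNge tb.
split=> //; rewrite lt_neqAle tb andbT.
by apply/eqP => tbE; apply: ntb; rewrite tbE.
Qed.

(** Such a [U] tends to the left end of the gap of [t] through points of every [V j]; [nsimP] makes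
    the base sets nonempty. *)
Let left_ultra t : V 0 t -> (t <= rep t)%O -> exists U : set_system K,
  UltraFilter U /\ forall j s, (s < t)%O -> ~ sim s t ->
    U [set u | V j u /\ (s < u <= t)%O].
Proof.
move=> Vt tr; pose D := [set p : nat * K | (p.2 < t)%O /\ ~ sim p.2 t].
pose F := filter_from D (fun p => [set u | V p.1 u /\ (p.2 < u <= t)%O]).
have FF : ProperFilter F.
  apply: filter_from_proper; last first.
    by move=> [j s] /= [st nst]; have [u] := nsimP j st nst; exists u.
  apply: filter_from_filter.
    by exists (0%N, a); exact: left_a.
  move=> [i s] [j s'] /= [st nst] [st' nst'].
  exists (maxn i j, Order.max s s'); first by rewrite /= maxEle; case: ifP.
  move=> u /= [Vu]; rewrite gt_max => /andP[/andP[-> ->] ->]; split; split=> //.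
    exact: Vdecr (leq_maxl _ _) _ Vu.
  exact: Vdecr (leq_maxr _ _) _ Vu.
have [U [UU FU]] := ultraFilterLemma FF.
by exists U; split=> // j s st nst; apply: FU; exists (j, s).
Qed.

Let right_ultra t : V 0 t -> (rep t < t)%O -> exists U : set_system K,
  UltraFilter U /\ forall j s, (t < s)%O -> ~ sim t s ->
    U [set u | V j u /\ (t < u <= s)%O].
Proof.
move=> Vt tr; pose D := [set p : nat * K | (t < p.2)%O /\ ~ sim t p.2].
pose F := filter_from D (fun p => [set u | V p.1 u /\ (t < u <= p.2)%O]).
have FF : ProperFilter F.
  apply: filter_from_proper; last first.
    by move=> [j s] /= [st nst]; have [u] := nsimP j st nst; exists u.
  apply: filter_from_filter.
    by exists (0%N, b); exact: right_b.
  move=> [i s] [j s'] /= [st nst] [st' nst'].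
  exists (maxn i j, Order.min s s'); first by rewrite /= minEle; case: ifP.
  move=> u /= [Vu]; rewrite le_min => /andP[-> /andP[-> ->]]; split; split=> //.
    exact: Vdecr (leq_maxl _ _) _ Vu.
  exact: Vdecr (leq_maxr _ _) _ Vu.
have [U [UU FU]] := ultraFilterLemma FF.
by exists U; split=> // j s st nst; apply: FU; exists (j, s).
Qed.

(* [rho] retracts a neighbourhood of the intersection of the sets [V j] (in the
   space of cuts) onto that intersection, every complementary gap being split
   at a point [rep] and folded towards its two ends. *)
Lemma ultrafilter_retraction : exists rho : K -> set_system K,
  [/\ forall t, UltraFilter (rho t),
    forall t j, V 0 t -> rho t (V j) &
    forall s, exists k, forall t, V k t ->
      ((t <= s)%O -> rho t [set u | (u <= s)%O]) /\
      ((s < t)%O -> rho t [set u | (s < u)%O])].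
Proof.
have /choice[rho rhoP] t : exists U : set_system K, UltraFilter U /\ (V 0 t ->
    ((t <= rep t)%O -> forall j s, (s < t)%O -> ~ sim s t ->
      U [set u | V j u /\ (s < u <= t)%O]) /\
    ((rep t < t)%O -> forall j s, (t < s)%O -> ~ sim t s ->
      U [set u | V j u /\ (t < u <= s)%O])).
  have [Vt|nVt] := pselect (V 0 t); last first.
    by exists (principal_filter t); split=> //; exact: principal_filter_ultra.
  have [tr|rt] := leP t (rep t).
    by have [U [UU UP]] := left_ultra Vt tr; exists U.
  by have [U [UU UP]] := right_ultra Vt rt; exists U.
have rhoU t : UltraFilter (rho t) := (rhoP t).1.
exists rho; split=> // [t j Vt|s].
  have [Hl Hr] := (rhoP t).2 Vt; have [tr|rt] := leP t (rep t).
    have [at_ nat_] := left_a Vt tr.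
    by apply: filterS (Hl tr j a at_ nat_) => u [].
  have [tb ntb] := right_b Vt rt.
  by apply: filterS (Hr rt j b tb ntb) => u [].
(* Only points [t] in the gap of [s] could be carried across [s]. There [rep t = rep s], and for
   points of [V k] lying below [rep s] is the same as lying below [s]; so those below [s] are folded
   to the left and those above to the right. *)
have [k kP] := rep_sim s; exists k => t Vkt.
have Vt : V 0 t := Vdecr (leq0n k) Vkt; have [Hl Hr] := (rhoP t).2 Vt.
have [tr|rt] := leP t (rep t).
  have [at_ nat_] := left_a Vt tr; split=> [ts|st].
    apply: filterS (Hl tr 0%N a at_ nat_) => u [_ /andP[_ ut]].
    exact: le_trans ts.
  have [ss|nss] := pselect (sim s t); last first.
    by apply: filterS (Hl tr 0%N s st nss) => u [_ /andP[]].
  exfalso; move: st; rewrite ltNge -(kP _ Vkt) (repE ss) => /negP; exact.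
have [tb ntb] := right_b Vt rt; split=> [|st]; last first.
  by apply: filterS (Hr rt 0%N b tb ntb) => u [_ /andP[tu _]]; exact: lt_trans tu.
rewrite le_eqVlt => /orP[/eqP ts|ts].
  have := kP _ Vkt; rewrite -ts lexx => /idP.
  by rewrite leNgt rt.
have [ss|nss] := pselect (sim t s); last first.
  by apply: filterS (Hr rt 0%N s ts nss) => u [_ /andP[]].
by have := kP _ Vkt; rewrite -(repE ss) (ltW ts) leNgt rt.
Qed.

End retraction.

(** * Repairing the measures on intervals *)

Section good_intervals.
Context {d : Order.disp_t} {K : compactLineType d} {R : realType}.
Context {E : normedModType R} (ev : E -> K -> R).
Context (c : nat -> K) (phi : nat -> (K -> R) -> R) (M eps eps' : R).
Context (y : nat -> E -> R).
Implicit Types (I J : K * K) (f : E) (s t u v : K).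

Hypothesis ev_cont : forall f, continuous (ev f).
Hypothesis ev_le : forall f t, `|ev f t| <= `|f|.
Hypothesis c_fine : forall f (e : R), 0 < e -> exists k, fine (mkseq c k) (ev f) e.
Hypothesis phiM : forall n, charge_le M (phi n).
Hypothesis phi_c : forall i,
  (fun n => phi n (fun t => (t <= c i)%O%:R)) @ \oo --> (0 : R).
Hypothesis eps'_gt0 : 0 < eps'.
Hypothesis eps'_lt : eps' < eps.
Hypothesis y_bounded : forall i, exists N : R, forall f, `|f| <= 1 -> `|y i f| <= N.
Hypothesis y_dense : forall t, exists i, forall f, `|f| <= 1 ->
  `|ev f t - y i f| < eps'.

Let inC := range c.

Let bev f : bounded_on [set: K] (ev f).
Proof. by exists `|f| => t _; exact: ev_le. Qed.

Let bind (P : pred K) := @bounded_on_pred K R P.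

(* Write [R_n g] for the function sending [t] to the limit of [g] along [rho n t].
   The third clause makes [g |-> phi n (1_I (g - R_n g))] weak* null, and the
   fourth one makes [f |-> phi n (1_I R_n f)] small on the unit ball of [E]: up
   to [eps], [R_n f] is a function [h] that [phi n] nearly annihilates. *)
Definition good I := exists rho : nat -> K -> set_system K,
  [/\ forall n t, UltraFilter (rho n t),
    forall n t, oc I t -> rho n t (oc I),
    forall s, (fun n => phi n (fun t => (oc I t)%:R * ((t <= s)%O%:R -
      ulim (rho n t) (fun u => (u <= s)%O%:R)))) @ \oo --> (0 : R) &
    forall eta, 0 < eta -> \forall n \near \oo, forall f, `|f| <= 1 ->
      exists h : K -> R,
        (forall t, oc I t -> `|ulim (rho n t) (ev f) - h t| <= eps) /\
        `|phi n (fun t => (oc I t)%:R * h t)| <= eta].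

(** The hereditary form of [good] is stable under cutting at points of [inC], as
    [disjoint_intervals] demands. *)
Definition hgood I := [/\ inC I.1, inC I.2 & forall a b, inC a -> inC b ->
  (I.1 <= a)%O -> (b <= I.2)%O -> good (a, b)].

Lemma good_empty I : (forall t, ~~ oc I t) -> good I.
Proof.
move=> I0; have z (g : K -> R) n : phi n (fun t => (oc I t)%:R * g t) = 0.
  rewrite -[RHS](charge0 (phiM n)); congr (phi n _); apply/funext => t.
  by rewrite (negbTE (I0 t)) mul0r.
exists (fun _ => principal_filter); split.
- by move=> _ t; exact: principal_filter_ultra.
- by move=> _ t; rewrite (negbTE (I0 t)).
- by move=> s; under eq_fun do rewrite z; exact: cvg_cst.
- move=> eta eta0; apply: filterE => n f _; exists (fun=> 0); split=> [t|].
    by rewrite (negbTE (I0 t)).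
  by rewrite z normr0 ltW.
Qed.

Lemma hgood_sub I a b : hgood I -> inC a -> inC b -> (I.1 <= a)%O ->
  (b <= I.2)%O -> hgood (a, b).
Proof.
move=> [_ _ IP] aC bC Ia bI; split=> // a' b' a'C b'C /= aa' b'b.
by apply: IP => //; [exact: le_trans aa'|exact: le_trans bI].
Qed.

Lemma hgood_empty I : inC I.1 -> inC I.2 -> (forall t, ~~ oc I t) -> hgood I.
Proof.
move=> I1 I2 I0; split=> // a b _ _ Ia bI; apply: good_empty => t.
apply: contra (I0 t) => /andP[/= at_ tb]; apply/andP; split.
  exact: le_lt_trans at_.
exact: le_trans bI.
Qed.

Lemma phi_oc a b : inC a -> inC b ->
  (fun n => phi n (fun t => (oc (a, b) t)%:R)) @ \oo --> (0 : R).
Proof.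
move=> [i _ <-] [j _ <-]; have [ij|ji] := leP (c i) (c j); last first.
  rewrite (_ : (fun n => _) = fun=> 0); first exact: cvg_cst.
  apply/funext => n; rewrite -[RHS](charge0 (phiM n)); congr (phi n _).
  apply/funext => t; rewrite /oc/=; case: ltP => //= it.
  by rewrite leNgt (lt_trans ji it).
have bij := ij;rewrite (_ : (fun n => _) = fun n =>
    phi n (fun t => (t <= c j)%O%:R) - phi n (fun t => (t <= c i)%O%:R)).
  by rewrite -[0](subrr (0 : R)); exact: cvgB.
apply/funext => n; rewrite -(chargeB (phiM n))//; congr (phi n _).
apply/funext => t; rewrite /oc/= ltNge; case ti: (t <= c i)%O => /=.
  by rewrite (le_trans ti ij) subrr.
by rewrite subr0.
Qed.

(** Each point of [l] splits the interval in two, and one of the halves belongs to [U]. *)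
Lemma ultra_same_side (U : set_system K) (l : seq K) a b : UltraFilter U ->
  {in l, forall t, inC t} -> inC a -> inC b -> U (oc (a, b)) ->
  exists a' b', [/\ inC a', inC b', (a <= a')%O, (b' <= b)%O & U (oc (a', b')) /\
    forall u v, oc (a', b') u -> oc (a', b') v -> same_side l u v].
Proof.
move=> UU; elim: l a b => [|s l IH] a b lC aC bC Uab.
  by exists a, b; split; rewrite ?lexx.
have sC : inC s by apply: lC; rewrite mem_head.
have lC' : {in l, forall t, inC t} by move=> t tl; apply: lC; rewrite inE tl orbT.
have [Us|Us] := in_ultra_setVsetC [set u | (u <= s)%O] UU.
  have [||a' [b' [a'C b'C aa' b'b [Uab' same]]]] := IH a (Order.min b s) lC' aC.
  - by rewrite minEle; case: ifP.
  - apply: filterS (filterI Uab Us) => u [/andP[/= au ub] /= us].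
    by rewrite /oc /= au le_min ub.
  move: b'b; rewrite le_min => /andP[b'b b's].
  exists a', b'; split=> //; split=> // u v u' v' t; rewrite inE => /orP[/eqP ->|tl].
    have /andP[_ /= ub'] := u'; have /andP[_ /= vb'] := v'.
    by rewrite (le_trans ub' b's) (le_trans vb' b's).
  exact: same.
have [||a' [b' [a'C b'C aa' b'b [Uab' same]]]] := IH (Order.max a s) b lC' _ bC.
- by rewrite maxEle; case: ifP.
- apply: filterS (filterI Uab Us) => u [/andP[/= au ub] /= /negP us].
  by rewrite /oc /= ub gt_max au ltNge us.
move: aa'; rewrite ge_max => /andP[aa' sa'].
exists a', b'; split=> //; split=> // u v u' v' t; rewrite inE => /orP[/eqP ->|tl].
  have /andP[/= a'u _] := u'; have /andP[/= a'v _] := v'.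
  by rewrite !leNgt (le_lt_trans sa' a'u) (le_lt_trans sa' a'v).
exact: same.
Qed.

Section step.
Context (a b : K) (i0 : nat).
Hypothesis aC : inC a.
Hypothesis bC : inC b.
Hypothesis ab : (a <= b)%O.
Hypothesis step_hyp : forall a' b', inC a' -> inC b' -> (a <= a')%O ->
  (b' <= b)%O -> (exists2 f, `|f| <= 1 &
    forall t, oc (a', b') t -> eps' <= `|ev f t - y i0 f|) -> hgood (a', b').

Let P I := [/\ hgood I, (a <= I.1)%O & (I.2 <= b)%O].

(** Intervals with ends in the range of [c] can be enumerated, so all hereditarily good ones can be
    listed and made disjoint. The empty interval [(a, a)] is the default. *)
Lemma exists_exhaustion : exists B : nat -> K * K, [/\ forall j, P (B j),
  forall i j t, oc (B i) t -> oc (B j) t -> i = j &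
  forall I, P I -> exists m, forall t, oc I t -> exists2 j, (j < m)%N & oc (B j) t].
Proof.
have Paa : P (a, a).
  split=> //; apply: hgood_empty => // t.
  by apply/negP => /andP[/= /lt_le_trans at_ /at_]; rewrite ltxx.
pose w k : K * K := if unpickle k is Some (i, j) then
  if `[< P (c i, c j) >] then (c i, c j) else (a, a) else (a, a).
have Pw k : P (w k).
  by rewrite /w; case: unpickle => // -[i j]; case: asboolP.
have [|[? ?] [[]]//|B [PB B_disj Bw]] := @disjoint_intervals _ K P inC w _ _ Pw.
  move=> I x z [hI aI Ib] xC zC Ix zI; split; first exact: hgood_sub hI _ _ _ _.
    exact: le_trans Ix.
  exact: le_trans Ib.
exists B; split=> // -[x z] Pxz; have [[[i _ /= iE] [j _ /= jE] _] _ _] := Pxz.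
have [m mP] := Bw (pickle (i, j)); exists m => t xt; apply: mP.
by rewrite /w pickleK asboolT ?iE ?jE.
Qed.


(** The first [kappa n] of the disjoint good intervals keep their own retractions. On the rest,
    [V (kappa n)], a common retraction [r] eventually brings every [f] of the unit ball within [eps]
    of the constant [y i0 f]. Letting [kappa n] grow slowly makes the total error vanish. *)
Lemma good_step : good (a, b).
Proof.
have [B [PB B_disj B_exh]] := exists_exhaustion.
have Bab j t : oc (B j) t -> oc (a, b) t.
  have [_ aB Bb] := PB j; move=> /andP[Bt tB]; apply/andP; split.
    exact: le_lt_trans aB Bt.
  exact: le_trans tB Bb.
have BC j : inC (B j).1 /\ inC (B j).2 by have [[? ? _] _ _] := PB j.
have Bgood j : good (B j).
  have [[B1 B2 Bsub] _ _] := PB j; rewrite [B j]surjective_pairing.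
  exact: Bsub.
have /choice[rho rhoP] := Bgood.
have rhoU j n t : UltraFilter (rho j n t) by have [+ _ _ _] := rhoP j.
pose Vb k t := oc (a, b) t && ~~ [exists j : 'I_k, oc (B j) t].
pose V k : set K := [set t | Vb k t].
have VP k t : V k t -> forall j, (j < k)%N -> ~~ oc (B j) t.
  by move=> /andP[_ /existsPn nB] j jk; exact: (nB (Ordinal jk)).
have Vab k : V k `<=` oc (a, b) by move=> t /andP[].
have Vdecr i j : (i <= j)%N -> V j `<=` V i.
  move=> ij t /[dup] Vjt /andP[abt _]; apply/andP; split=> //.
  by apply/existsPn => k; apply: (VP _ _ Vjt); rewrite (leq_trans _ ij).
have VorB k t : oc (a, b) t -> V k t \/ exists2 j, (j < k)%N & oc (B j) t.
  move=> abt; have [/existsP[j Bj]|nB] := boolP [exists j : 'I_k, oc (B j) t].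
    by right; exists j.
  by left; rewrite /V /= /Vb abt.
(* If all [V j] are nonempty, this is the retraction constructed before. Otherwise finitely many
   [B j] already cover [oc (a, b)], and principal filters will do. *)
have [r [rU rab [k0 rV] rs]] : exists r : K -> set_system K,
    [/\ forall t, UltraFilter (r t), forall t, V 0 t -> r t (oc (a, b)),
     exists k0, forall k t, (k0 <= k)%N -> V k t -> forall j, r t (V j) &
     forall s, exists k, forall t, V k t ->
      ((t <= s)%O -> r t [set u | (u <= s)%O]) /\
      ((s < t)%O -> r t [set u | (s < u)%O])].
  have [Vn0|] := pselect (forall j, V j !=set0).
    have [r [rU rV rs]] := ultrafilter_retraction (Vab 0%N) Vdecr Vn0.
    exists r; split=> //.
      by move=> t Vt; apply: filterS (rV t 0%N Vt); exact: Vab.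
    by exists 0%N => k t _ Vt j; apply: rV; exact: Vdecr (leq0n k) _ Vt.
  move=> /existsNP[j Vj]; exists principal_filter; split.
  - exact: principal_filter_ultra.
  - by move=> t Vt; apply/principal_filterP; exact: Vab Vt.
  - exists j => k t jk Vt; exfalso; apply: Vj; exists t; exact: Vdecr jk _ Vt.
  - by move=> s; exists j => t Vt; exfalso; apply: Vj; exists t.
(* Otherwise [f] stays at least [eps'] away from [y i0 f] on a whole subinterval belonging to [r t].
   By [step_hyp] this subinterval is hereditarily good, so finitely many [B j] cover it, whereas
   [r t] contains every [V m]. *)
have r_close t k f : (k0 <= k)%N -> V k t -> `|f| <= 1 ->
    `|ulim (r t) (ev f) - y i0 f| <= eps.
  move=> k0k Vt f1; rewrite leNgt; apply/negP => gt_eps.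
  have del0 : 0 < eps - eps' by rewrite subr_gt0.
  have [k1 k1f] := c_fine f del0.
  have Uab : r t (oc (a, b)) by apply: rab; exact: Vdecr (leq0n k) _ Vt.
  have lC : {in mkseq c k1, forall t, inC t}.
    by move=> _ /mapP[i _ ->]; exists i.
  have [a' [b' [a'C b'C aa' b'b [Uab' same]]]] :=
    ultra_same_side (rU t) lC aC bC Uab.
  have close u : oc (a', b') u -> `|ulim (r t) (ev f) - ev f u| <= eps - eps'.
    move=> uab'; apply: ulim_dist => //; apply: filterS Uab' => v vab'.
    by apply: k1f; exact: same.
  have hP : hgood (a', b').
    apply: step_hyp => //; exists f => // u uab'.
    have := ler_distD (ev f u) (ulim (r t) (ev f)) (y i0 f).
    by have := close u uab'; lra.
  have [m mB] := B_exh (a', b') (And3 hP aa' b'b).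
  have [u [u1 u2]] := filter_ex (filterI Uab' (rV k t k0k Vt m)).
  have [j jm Bju] := mB u u1.
  by have := VP _ _ u2 j jm; rewrite Bju.
have phi_V k : (fun n => phi n (fun t => (Vb k t)%:R)) @ \oo --> (0 : R).
  elim: k => [|k IH].
    rewrite (_ : (fun n => _) = fun n => phi n (fun t => (oc (a, b) t)%:R)).
      exact: phi_oc.
    apply/funext => n; congr (phi n _); apply/funext => t; rewrite /Vb.
    by case: existsP => [[[]]//|_]; rewrite andbT.
  rewrite (_ : (fun n => _) = fun n => phi n (fun t => (Vb k t)%:R) -
      phi n (fun t => (oc ((B k).1, (B k).2) t)%:R)).
    by rewrite -[0](subrr (0 : R)); apply: cvgB => //; apply: phi_oc; apply BC.
  apply/funext => n; rewrite -(chargeB (phiM n))//; congr (phi n _).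
  apply/funext => t; rewrite -surjective_pairing; have [Bkt|nBkt] := boolP (oc (B k) t).
    have -> : Vb k t.
      have [//|[j jk Bjt]] := VorB k t (Bab _ _ Bkt).
      by move: jk; rewrite (B_disj _ _ _ Bjt Bkt) ltnn.
    rewrite subrr (_ : Vb k.+1 t = false)//; apply/negP => /VP /(_ k (ltnSn k)).
    by rewrite Bkt.
  rewrite subr0; suff -> : Vb k.+1 t = Vb k t by [].
  apply/idP/idP => [/(Vdecr _ _ (leqnSn k))//|Vt].
  apply/andP; split; first exact: Vab Vt.
  apply/existsPn => -[j /=]; rewrite ltnS leq_eqVlt => /orP[/eqP ->//|jk].
  exact: VP Vt j jk.
have [N yN] := y_bounded i0.
(* The [k] interval errors of size [(k.+1%:R ^+ 2)^-1] will add up to at most [k.+1%:R^-1]. *)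
pose Q k n := (forall j, (j < k)%N -> forall f, `|f| <= 1 ->
      exists h : K -> R,
        (forall t, oc (B j) t -> `|ulim (rho j n t) (ev f) - h t| <= eps) /\
        `|phi n (fun t => (oc (B j) t)%:R * h t)| <= (k.+1%:R ^+ 2)^-1) /\
  `|phi n (fun t => (Vb k t)%:R)| <= k.+1%:R^-1.
have [k|kappa [kappa_oo kappaQ]] := @nat_diagonal Q.
  have k1 : 0 < k.+1%:R^-1 :> R by rewrite invr_gt0.
  have k2 : 0 < (k.+1%:R ^+ 2)^-1 :> R by rewrite invr_gt0 exprn_gt0.
  have Qj : \forall n \near \oo, forall j, (j < k)%N -> forall f, `|f| <= 1 ->
      exists h : K -> R,
        (forall t, oc (B j) t -> `|ulim (rho j n t) (ev f) - h t| <= eps) /\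
        `|phi n (fun t => (oc (B j) t)%:R * h t)| <= (k.+1%:R ^+ 2)^-1.
    by apply: filter_forall_lt => j _; have [_ _ _] := rhoP j; exact.
  have /cvgr0Pnorm_le/(_ _ k1) QV := phi_V k.
  by apply: filterS (filterI Qj QV) => n [].
pose sigma n t := if [pick j : 'I_(kappa n) | oc (B j) t] is Some j
  then rho j n t else r t.
have sigmaB n j t : (j < kappa n)%N -> oc (B j) t -> sigma n t = rho j n t.
  move=> jk Bjt; rewrite /sigma; case: pickP => [i Bit|/(_ (Ordinal jk))].
    by rewrite (B_disj _ _ _ Bit Bjt).
  by rewrite /= Bjt.
have sigmaV n t : V (kappa n) t -> sigma n t = r t.
  move=> Vt; rewrite /sigma; case: pickP => // i Bit.
  by have := VP _ _ Vt _ (ltn_ord i); rewrite Bit.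
exists sigma; split.
- move=> n t; rewrite /sigma; case: pickP => [j _|_]; [exact: rhoU|exact: rU].
- move=> n t abt; have [Vt|[j jk Bjt]] := VorB (kappa n) t abt.
    by rewrite sigmaV//; apply: rab; exact: Vdecr (leq0n _) _ Vt.
  rewrite (sigmaB _ _ _ jk Bjt); have [_ + _ _] := rhoP j.
  by move=> /(_ n t Bjt); apply: filterS => u; exact: Bab.
(* Limits along [sigma] do not change the initial segment of [s] on a late [V k], nor on a [B j]
   that does not contain [s]. At most one interval remains, and its own [rho] deals with it. *)
- move=> s; pose D u : R := (u <= s)%O%:R.
  have bD : bounded_on [set: K] D by exact: bind.
  have [ks ksP] := rs s.
  have V0 t : V ks t -> D t - ulim (r t) D = 0.
    move=> /ksP[rle rgt]; apply/eqP; rewrite subr_eq0; apply/eqP/esym.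
    apply: ulim_eq => //; rewrite /D; have [ts|st] := leP t s.
      by apply: filterS (rle ts) => u /= ->.
    by apply: filterS (rgt st) => u /=; rewrite leNgt => ->.
  have B0 n j t : oc (B j) t -> ~~ oc (B j) s -> D t - ulim (rho j n t) D = 0.
    move=> Bjt nBjs; apply/eqP; rewrite subr_eq0; apply/eqP/esym.
    apply: ulim_eq => //; have [_ + _ _] := rhoP j => /(_ n t Bjt).
    apply: filterS => u; move: Bjt nBjs => /andP[Bt tB] + /andP[Bu uB].
    rewrite /oc negb_and -leNgt -ltNge => /orP[sB|Bs]; rewrite /D /=.
      by rewrite !leNgt (le_lt_trans sB Bt) (le_lt_trans sB Bu).
    by rewrite (le_trans tB (ltW Bs)) (le_trans uB (ltW Bs)).
  have [[j0 Bs]|nBs] := pselect (exists j, oc (B j) s).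
    have [_ _ + _] := rhoP j0 => /(_ s); apply: cvg_trans; apply: near_eq_cvg.
    near=> n; have ksn : (ks <= kappa n)%N by near: n; exact: kappa_oo.
    have jn : (j0 < kappa n)%N by near: n; exact: kappa_oo.
    congr (phi n _); apply/funext => t.
    have [abt|nabt] := boolP (oc (a, b) t); last first.
      rewrite (_ : oc (B j0) t = false) ?mul0r//; apply/negP => /Bab.
      by apply/negP.
    have [Vt|[j jk Bjt]] := VorB (kappa n) t abt.
      rewrite (negbTE (VP _ _ Vt _ jn)) mul0r sigmaV// V0 ?mulr0//.
      exact: Vdecr ksn _ Vt.
    rewrite (sigmaB _ _ _ jk Bjt); have [<-|jj0] := eqVneq j j0; first by rewrite Bjt.
    have nBj0t : oc (B j0) t = false.
      by apply/negP => Bj0t; move: jj0; rewrite (B_disj _ _ _ Bjt Bj0t) eqxx.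
    have nBjs : ~~ oc (B j) s.
      by apply/negP => Bjs; move: jj0; rewrite (B_disj _ _ _ Bjs Bs) eqxx.
    by rewrite nBj0t mul0r (B0 _ _ _ Bjt nBjs) mulr0.
  apply: cvg_near_cst; near=> n.
  have ksn : (ks <= kappa n)%N by near: n; exact: kappa_oo.
  rewrite -[RHS](charge0 (phiM n)); congr (phi n _); apply/funext => t.
  have [abt|nabt] := boolP (oc (a, b) t); last by rewrite mul0r.
  have [Vt|[j jk Bjt]] := VorB (kappa n) t abt.
    rewrite sigmaV// V0 ?mulr0//; exact: Vdecr ksn _ Vt.
  have nBjs : ~~ oc (B j) s by apply/negP => Bjs; apply: nBs; exists j.
  by rewrite (sigmaB _ _ _ jk Bjt) (B0 _ _ _ Bjt nBjs) mulr0.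
- move=> eta eta0.
  (* The absolute value of [N] is for the constant [y i0 f] on the rest, the [1] for the sum over
     the intervals. *)
  have [m] : exists m, 0 + m.+1%:R^-1 < eta / (`|N| + 1).
    by apply: ltr_add_invr; rewrite divr_gt0// ltr_wpDl.
  rewrite add0r ltr_pdivlMr ?ltr_wpDl// => mP.
  near=> n => f f1.
  have k0n : (k0 <= kappa n)%N by near: n; exact: kappa_oo.
  have mn : (m <= kappa n)%N by near: n; exact: kappa_oo.
  have [QB QV] : Q (kappa n) n by near: n.
  have /choice[h hP] j : exists h : K -> R, (j < kappa n)%N ->
        (forall t, oc (B j) t -> `|ulim (rho j n t) (ev f) - h t| <= eps) /\
        `|phi n (fun t => (oc (B j) t)%:R * h t)| <= ((kappa n).+1%:R ^+ 2)^-1.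
    have [jk|kj] := ltnP j (kappa n); first by have [h hP] := QB j jk f f1; exists h.
    by exists (fun=> 0).
  pose hh t := if [pick j : 'I_(kappa n) | oc (B j) t] is Some j
    then h j t else y i0 f.
  have hhB j t : (j < kappa n)%N -> oc (B j) t -> hh t = h j t.
    move=> jk Bjt; rewrite /hh; case: pickP => [i Bit|/(_ (Ordinal jk))].
      by rewrite (B_disj _ _ _ Bit Bjt).
    by rewrite /= Bjt.
  have hhV t : V (kappa n) t -> hh t = y i0 f.
    move=> Vt; rewrite /hh; case: pickP => // i Bit.
    by have := VP _ _ Vt _ (ltn_ord i); rewrite Bit.
  exists hh; split=> [t abt|].
    have [Vt|[j jk Bjt]] := VorB (kappa n) t abt.
      by rewrite sigmaV// hhV//; exact: (r_close _ (kappa n)).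
    by rewrite (sigmaB _ _ _ jk Bjt) (hhB _ _ jk Bjt); apply (hP j jk).
  have -> : (fun t => (oc (a, b) t)%:R * hh t) =
      fun t => y i0 f * (Vb (kappa n) t)%:R +
        \sum_(j < kappa n) (oc (B j) t)%:R * h j t.
    apply/funext => t; have [abt|nabt] := boolP (oc (a, b) t); last first.
      rewrite mul0r /Vb (negbTE nabt) mulr0 add0r big1// => j _.
      by rewrite (_ : oc (B j) t = false) ?mul0r//; apply/negP => /Bab; apply/negP.
    have [Vt|[j jk Bjt]] := VorB (kappa n) t abt.
      rewrite hhV// mul1r (_ : Vb _ _) ?mulr1 ?big1 ?addr0// => j _.
      by rewrite (negbTE (VP _ _ Vt _ (ltn_ord j))) mul0r.
    rewrite (hhB _ _ jk Bjt) (_ : Vb _ _ = false) ?mulr0 ?add0r; last first.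
      by apply/negP => /VP /(_ j jk); rewrite Bjt.
    rewrite (bigD1 (Ordinal jk))//= big1 ?addr0 ?Bjt// => i ij.
    rewrite (_ : oc (B i) t = false) ?mul0r//; apply/negP => Bit.
    by move: ij; rewrite -val_eqE /= (B_disj _ _ _ Bit Bjt) eqxx.
  have bh j : (j < kappa n)%N ->
      bounded_on [set: K] (fun t => (oc (B j) t)%:R * h j t).
    move=> jk; exists (1 + eps) => t _; have e0 : 0 < eps by exact: lt_trans eps'_lt.
    have [Bjt|nBjt] := boolP (oc (B j) t); last first.
      by rewrite mul0r normr0 addr_ge0// ltW.
    rewrite mul1r -[h j t](subKr (ulim (rho j n t) (ev f))).
    rewrite (le_trans (ler_normB _ _))// lerD//; last by apply (hP j jk).
    apply: ulim_norm_le => u.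
    exact: le_trans (ev_le _ _) f1.
  have bV : bounded_on [set: K] (fun t => y i0 f * (Vb (kappa n) t)%:R).
    exists `|y i0 f| => t _; rewrite normrM ler_piMr//.
    by case: (Vb _ _); rewrite ?normr1 ?normr0.
  rewrite (chargeD (phiM n))//; last exact: (@bounded_on_sum _ _ _ (fun j t => (oc (B j) t)%:R * h j t)).
  rewrite (chargeZ (phiM n))//.
  rewrite (@charge_sum _ _ _ _ (phiM n) _ (fun j t => (oc (B j) t)%:R * h j t))//.
  set k := kappa n in QV hP mn *.
  have kk : k.+1%:R^-1 <= m.+1%:R^-1 :> R by rewrite lef_pV2 ?posrE// ler_nat ltnS.
  have k_gt0 : 0 < k.+1%:R :> R by [].
  have sum_le : `|\sum_(j < k) phi n (fun t => (oc (B j) t)%:R * h j t)| <= k.+1%:R^-1.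
    rewrite (le_trans (ler_norm_sum _ _ _))//.
    apply: (@le_trans _ _ (\sum_(j < k) (k.+1%:R ^+ 2)^-1)).
      by apply: ler_sum => j _; apply (hP j (ltn_ord j)).
    rewrite sumr_const card_ord -[leLHS]mulr_natl expr2 invfM mulrA.
    rewrite -[leRHS]mul1r ler_pM2r ?invr_gt0// ler_pdivrMr// mul1r ler_nat.
    exact: leqnSn.
  have yfN : `|y i0 f| <= `|N| by rewrite (le_trans (yN f f1))// ler_norm.
  rewrite (le_trans (ler_normD _ _))// normrM.
  apply: (le_trans (lerD (ler_pM _ _ yfN QV) sum_le)) => //.
  apply: le_trans (ltW mP).
  by rewrite -[X in _ + X]mul1r -mulrDl mulrC ler_wpM2r.
Unshelve. all: by end_near. Qed.

End step.

(** The category argument. From a bad interval, [good_step] yields nested bad intervals [J n] such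
    that some [f] of the unit ball is at least [eps'] away from [y n f] on [J n.+1]. At a cluster
    point [x] the evaluation is within [eps'] of some [y i], which contradicts the continuity of the
    corresponding [f]. *)
Lemma hgood_oc a b : inC a -> inC b -> hgood (a, b).
Proof.
move=> aC bC; apply: contrapT => nab.
pose bad I := [/\ inC I.1, inC I.2 & ~ hgood I].
have /choice[next nextP] (p : nat * (K * K)) : exists J, bad p.2 ->
    [/\ bad J, oc J `<=` oc p.2 & exists2 f, `|f| <= 1 &
      forall t, oc J t -> eps' <= `|ev f t - y p.1 f|].
  case: p => i I /=; have [[I1 I2 nI]|nbad] := pselect (bad I); last by exists I.
  apply: contrapT => nJ; apply: nI; split=> // a' b' a'C b'C Ia' b'I.
  have [ab'|ba'] := leP a' b'; last first.
    apply: good_empty => t; apply/negP => /andP[/= at_ tb].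
    by have := lt_trans (lt_le_trans at_ tb) ba'; rewrite ltxx.
  apply: (good_step (i0 := i)) => // x z xC zC ax zb fP.
  apply: contrapT => nxz; apply: nJ; exists (x, z) => _; split=> //.
  move=> t /andP[/= xt tz]; apply/andP; split.
    exact: le_lt_trans (le_trans Ia' ax) xt.
  exact: le_trans tz (le_trans zb b'I).
pose J := fix J n := if n is n'.+1 then next (n', J n') else (a, b).
have Jbad n : bad (J n).
  by elim: n => [|n IH]; [split|have [] := nextP (n, J n) IH].
have Jdecr m n : (m <= n)%N -> oc (J n) `<=` oc (J m).
  elim: n => [|n IH]; first by rewrite leqn0 => /eqP ->.
  rewrite leq_eqVlt => /orP[/eqP -> //|/IH]; apply: subset_trans.
  by have [] := nextP (n, J n) (Jbad n).
have Jne n : exists t, oc (J n) t.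
  apply: contrapT => /forallNP nJ; have [J1 J2] := Jbad n; apply.
  by apply: hgood_empty => // t; apply/negP/nJ.
pose F := filter_from [set: nat] (fun n => [set t | oc (J n) t]).
have FF : ProperFilter F.
  apply: filter_from_proper; last by move=> n _; have [t] := Jne n; exists t.
  apply: filter_from_filter; first by exists 0%N.
  move=> m n _ _; exists (maxn m n) => // t Jt; split.
    exact: Jdecr (leq_maxl _ _) _ Jt.
  exact: Jdecr (leq_maxr _ _) _ Jt.
have [|x [_ xF]] := @compact_setT K F FF; first by exists 0%N.
have [i ix] := y_dense x.
have [_ _ [f f1 fJ]] := nextP (i, J i) (Jbad i).
(* [x] may lie outside of [J i.+1], being only a cluster point, so the strict inequality is spread
   to a neighbourhood. *)
have nx : nbhs x [set t | `|ev f t - y i f| < eps'].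
  have fx : (fun t => `|ev f t - y i f|) @ x --> `|ev f x - y i f|.
    by apply: cvg_norm; apply: cvgB; [exact: ev_cont|exact: cvg_cst].
  exact: (cvgr_lt _ fx _ (ix f f1)).
have FJ : F [set t | oc (J i.+1) t] by exists i.+1.
have [t [Jt /=]] := xF _ _ FJ nx.
by rewrite ltNge fJ.
Qed.

End good_intervals.

(** * Extension of null sequences of functionals *)

Section approximate_extension.
Context {d : Order.disp_t} {K : compactLineType d} {R : realType}.
Context {E : normedModType R} (ev : E -> K -> R).
Context (c : nat -> K) (y : nat -> E -> R).
Implicit Types (f : E) (t : K).

Hypothesis ev_lin : forall (a : R) f g t, ev (a *: f + g) t = a * ev f t + ev g t.
Hypothesis ev_cont : forall f, continuous (ev f).
Hypothesis ev_norm : forall f, sup_norm [set: K] (ev f) = `|f|.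
Hypothesis ev_le : forall f t, `|ev f t| <= `|f|.
Hypothesis c_bot : exists i, forall t, (c i <= t)%O.
Hypothesis c_top : exists i, forall t, (t <= c i)%O.
Hypothesis c_fine : forall f (e : R), 0 < e ->
  exists k, fine (mkseq c k) (ev f) e.
Hypothesis y_bounded : forall i, exists N : R, forall f, `|f| <= 1 -> `|y i f| <= N.
Hypothesis y_dense : forall t (e : R), 0 < e -> exists i, forall f, `|f| <= 1 ->
  `|ev f t - y i f| < e.

Let bev f : bounded_on [set: K] (ev f).
Proof. by exists `|f| => t _; exact: ev_le. Qed.

Let ev0 t : ev 0 t = 0.
Proof.
have := ev_lin 1 0 0 t; rewrite scale1r addr0 mul1r => /eqP.
by rewrite -subr_eq0 opprD addrA subrr sub0r oppr_eq0 => /eqP.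
Qed.

Let evZ (a : R) f t : ev (a *: f) t = a * ev f t.
Proof. by have := ev_lin a f 0 t; rewrite addr0 ev0 addr0. Qed.

(** From [phi n] one subtracts its image under the retraction, on the line without its least point.
    The bound [4 * M] is twice the [2 * M] of [phi n], since [g] minus its retract has at most twice
    the norm of [g]. *)
Lemma approximate_extension (S : nat -> E -> R) (M : R) : 0 < M ->
  (forall n (a : R) f g, S n (a *: f + g) = a * S n f + S n g) ->
  (forall n f, `|S n f| <= M * `|f|) -> (forall f, S ^~ f @ \oo --> 0) ->
  exists psi : nat -> (K -> R) -> R, [/\ forall n, charge_le (4 * M) (psi n),
    forall g : K -> R, continuous g -> bounded_on [set: K] g ->
      psi ^~ g @ \oo --> 0 &
    forall n f, `|S n f - psi n (ev f)| <= M / 2 * `|f|].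
Proof.
move=> M0 Slin SM S0.
have bind P := @bounded_on_pred K R P.
have [|phi [phiM phiS phi_c]] := null_charge_extension (z := fun i t => (t <= c i)%O%:R)
    (ltW M0) bev ev_lin Slin _ S0 (fun i => bind _).
  by move=> n f; rewrite ev_norm.
(* With this [eps] the error [2 * M * eps] is [M / 8]; the least point and the function [h]
   contribute at most [M / 8] each, which leaves the sum below [M / 2]. *)
pose eps : R := 16%:R^-1; pose eps' : R := 32%:R^-1.
have eps0 : 0 < eps by rewrite invr_gt0.
have eps'0 : 0 < eps' by rewrite invr_gt0.
have eps'_lt : eps' < eps by rewrite ltf_pV2 ?posrE// ltr_nat.
have [ib botP] := c_bot; have [it topP] := c_top.
pose bot := c ib; pose top := c it.
have botC : range c bot by exists ib.
have topC : range c top by exists it.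
have [_ _ hg] : hgood ev c phi eps (bot, top).
  apply: (hgood_oc (y := y) ev_cont ev_le c_fine phiM phi_c eps'0 eps'_lt
    y_bounded) => // t; exact: y_dense.
have [rho [rhoU rhoI rhoD rho_close]] := hg bot top botC topC (lexx _) (lexx _).
pose I t : R := (oc (bot, top) t)%:R.
have I1 t : `|I t| <= 1 by rewrite /I; case: oc; rewrite ?normr1 ?normr0.
have IB (g : K -> R) (B : R) : 0 <= B -> (forall t, oc (bot, top) t -> `|g t| <= B) ->
    forall t, `|I t * g t| <= B.
  move=> B0 gB t; rewrite /I; have [/gB|_] := boolP (oc (bot, top) t).
    by rewrite mul1r.
  by rewrite mul0r normr0.
have bRg n (g : K -> R) (B : R) : 0 <= B -> (forall t, `|g t| <= B) ->
    forall t, `|I t * (g t - ulim (rho n t) g)| <= B + B.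
  move=> B0 gB; apply: IB => [|t _]; first by rewrite addr_ge0.
  by rewrite (le_trans (ler_normB _ _))// lerD//; exact: ulim_norm_le.
have bRg' n (g : K -> R) : bounded_on [set: K] g ->
    bounded_on [set: K] (fun t => I t * (g t - ulim (rho n t) g)).
  move=> [B gB]; pose C := Num.max 0 B.
  exists (C + C) => t _; apply: bRg => [|u]; first by rewrite le_max lexx.
  by rewrite le_max gB ?orbT.
pose psi0 n (g : K -> R) := phi n (fun t => I t * (g t - ulim (rho n t) g)).
have psi0M n : charge_le (4 * M) (psi0 n).
  split=> [a g h bg bh|g B B0 gB].
    rewrite /psi0 -(phiM n).1; [|exact: bRg'..].
    congr (phi n _); apply/funext => t; rewrite ulim_linear// opprD addrACA mulrDr.
    by rewrite -mulrBr mulrCA.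
  rewrite (le_trans ((phiM n).2 _ (B + B) _ _))//.
  - by rewrite addr_ge0.
  - exact: bRg.
  - lra.
have M8 : 0 < M / 8 by rewrite divr_gt0.
have [N0 _ N0P] : \forall n \near \oo, forall f, `|f| <= 1 ->
    `|S n f - psi0 n (ev f)| <= M / 2.
  have /cvgr0Pnorm_le/(_ _ M8) phib := phi_c ib.
  apply: filterS (filterI phib (rho_close _ M8)) => n [phibn hn] f f1.
  have [h [hP hM]] := hn f f1.
  rewrite -(phiS n) /psi0 -(chargeB (phiM n)) //; last exact: bRg'.
  have ulim1 t : `|ulim (rho n t) (ev f)| <= 1.
    by apply: ulim_norm_le => u; exact: le_trans (ev_le _ _) f1.
  have bIh : bounded_on [set: K] (fun t => I t * h t).
    exists (1 + eps) => t _; apply: IB => [|u uI]; first by rewrite addr_ge0// ltW.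
    rewrite -[h u](subKr (ulim (rho n u) (ev f))) (le_trans (ler_normB _ _))//.
    by rewrite lerD// hP.
  have IRh : forall t, `|I t * (ulim (rho n t) (ev f) - h t)| <= eps.
    by apply: IB => [|u uI]; [exact: ltW|apply: (hP u uI)].
  have bIRh : bounded_on [set: K] (fun t => I t * (ulim (rho n t) (ev f) - h t)).
    by exists eps => t _.
  (* The half-open interval misses exactly the point [bot], whence the first summand. *)
  rewrite (_ : (fun t => _) = fun t => ev f bot * (t <= bot)%O%:R +
      (I t * h t + I t * (ulim (rho n t) (ev f) - h t))); last first.
    apply/funext => t; rewrite /I /oc /= topP andbT ltNge.
    have [tb|bt] := leP t bot; last by rewrite /=; lra.
    have -> : t = bot by apply/eqP; rewrite eq_le tb botP.
    by rewrite /=; lra.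
  have bb : bounded_on [set: K] (fun t => ev f bot * (t <= bot)%O%:R).
    exists `|ev f bot| => t _; rewrite normrM ler_piMr//.
    by case: (t <= bot)%O; rewrite ?normr1 ?normr0.
  have bS (g h' : K -> R) : bounded_on [set: K] g -> bounded_on [set: K] h' ->
      bounded_on [set: K] (fun t => g t + h' t).
    move=> [B gB] [C hC]; exists (B + C) => t _.
    by rewrite (le_trans (ler_normD _ _))// lerD ?gB ?hC.
  rewrite (chargeD (phiM n))//; last exact: bS.
  rewrite (chargeZ (phiM n))// (chargeD (phiM n))//.
  have e1 : `|ev f bot * phi n (fun t => (t <= bot)%O%:R)| <= M / 8.
    rewrite normrM -[M / 8]mul1r ler_pM//; exact: le_trans (ev_le _ _) f1.
  have e2 : `|phi n (fun t => I t * (ulim (rho n t) (ev f) - h t))| <= 2 * M * eps.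
    by apply: (phiM n).2 => //; exact: ltW.
  have e3 : 2 * M * eps = M / 8 by rewrite /eps; lra.
  rewrite e3 in e2; rewrite (le_trans (ler_normD _ _))//.
  have := ler_normD (phi n (fun t => I t * h t))
    (phi n (fun t => I t * (ulim (rho n t) (ev f) - h t))).
  move: hM; rewrite -/(I _) => hM; lra.
(* For the finitely many [n] before [N0], [phi n] itself is an exact extension. *)
exists (fun n => if (N0 <= n)%N then psi0 n else phi n); split=> [n|g cg bg|n f].
- case: ifP => _ //; split; first exact: (phiM n).1.
  move=> g B B0 gB; rewrite (le_trans ((phiM n).2 _ _ B0 gB))// ler_wpM2r//.
  by rewrite ler_wpM2r ?ler_nat// ltW.
- have : psi0 ^~ g @ \oo --> 0 by exact: (charge_continuous_cvg0 psi0M).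
  apply: cvg_trans; apply: near_eq_cvg; near=> n.
  by rewrite ifT//; near: n; exists N0.
- have [nN|Nn] := leqP N0 n; last first.
    by rewrite phiS subrr normr0 mulr_ge0// divr_ge0// ltW.
  have [->|f0] := eqVneq f 0.
    have -> : ev 0 = fun=> 0 by apply/funext => t; exact: ev0.
    rewrite (charge0 (psi0M n)) subr0 normr0 mulr0.
    by have := SM n 0; rewrite normr0 mulr0.
  have nf0 : `|f| != 0 by rewrite normr_eq0.
  have [fE f1] : f = `|f| *: (`|f|^-1 *: f) /\ `| `|f|^-1 *: f | <= 1.
    by rewrite scalerA divff// scale1r normfZV.
  rewrite {1 2}fE; have -> : ev (`|f| *: (`|f|^-1 *: f)) =
      fun t => `|f| * ev (`|f|^-1 *: f) t by apply/funext => t; exact: evZ.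
  rewrite (chargeZ (psi0M n))//.
  have SZ (a : R) g : S n (a *: g) = a * S n g.
    have S00 : S n 0 = 0.
      by apply/eqP; rewrite -normr_le0; have := SM n 0; rewrite normr0 mulr0.
    by have := Slin n a g 0; rewrite addr0 S00 addr0.
  rewrite SZ -mulrBr normrM normr_id mulrC ler_wpM2r//.
  exact: N0P.
Unshelve. all: by end_near. Qed.

(* Summing the corrections obtained by iterating [approximate_extension]; the
   series converges geometrically, so a limit along any ultrafilter is its sum. *)
Lemma null_functional_extension (S : nat -> E -> R) (M : R) : 0 < M ->
  (forall n (a : R) f g, S n (a *: f + g) = a * S n f + S n g) ->
  (forall n f, `|S n f| <= M * `|f|) -> (forall f, S ^~ f @ \oo --> 0) ->
  exists psi : nat -> (K -> R) -> R, [/\ forall n, charge_le (8 * M) (psi n),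
    forall g : K -> R, continuous g -> bounded_on [set: K] g ->
      psi ^~ g @ \oo --> 0 &
    forall n f, psi n (ev f) = S n f].
Proof.
move=> M0 Slin SM S0.
(* [P k] describes what is left to extend after [k] corrections. *)
pose P k (Z : nat -> E -> R) := [/\
  forall n (a : R) f g, Z n (a *: f + g) = a * Z n f + Z n g,
  forall n f, `|Z n f| <= M / 2 ^+ k * `|f| & forall f, Z ^~ f @ \oo --> 0].
have Mk k : 0 < M / 2 ^+ k by rewrite divr_gt0// exprn_gt0.
have /choice[next nextP] (p : nat * (nat -> E -> R)) :
    exists psi : nat -> (K -> R) -> R, P p.1 p.2 ->
    [/\ forall n, charge_le (4 * (M / 2 ^+ p.1)) (psi n),
    forall g : K -> R, continuous g -> bounded_on [set: K] g ->
      psi ^~ g @ \oo --> 0 &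
    forall n f, `|p.2 n f - psi n (ev f)| <= M / 2 ^+ p.1 / 2 * `|f|].
  have [[Zlin ZM Z0]|nP] := pselect (P p.1 p.2); last by exists (fun _ _ => 0).
  by have [psi psiP] := approximate_extension (Mk p.1) Zlin ZM Z0; exists psi.
pose Z := fix Z k := if k is k'.+1
  then fun n f => Z k' n f - next (k', Z k') n (ev f) else S.
have ZP k : P k (Z k).
  elim: k => [|k IH]; first by split=> // n f; rewrite expr0 divr1.
  have [Zlin ZM Z0] := IH; have [psiM psi0 psiZ] := nextP (k, Z k) IH.
  split=> [n a f g|n f|f] /=.
  - rewrite Zlin (_ : ev (a *: f + g) = fun t => a * ev f t + ev g t); last first.
      by apply/funext => t; exact: ev_lin.
    by rewrite (psiM n).1// mulrBr opprD addrACA.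
  - by rewrite exprSr invfM mulrA; exact: psiZ.
  - rewrite -[0](subrr (0 : R)); apply: cvgB; first exact: Z0.
    exact: psi0.
pose psi k := next (k, Z k).
have psiP k := nextP (k, Z k) (ZP k).
pose X m n g := \sum_(k < m) psi k n g.
have XS m n f : X m n (ev f) = S n f - Z m n f.
  elim: m => [|m IH]; first by rewrite /X big_ord0 subrr.
  by rewrite /X big_ord_recr/= -/(X m n _) IH opprB addrA addrAC.
have Xlin m n (a : R) (g h : K -> R) : bounded_on [set: K] g ->
    bounded_on [set: K] h ->
    X m n (fun t => a * g t + h t) = a * X m n g + X m n h.
  move=> bg bh; rewrite /X mulr_sumr -big_split; apply: eq_bigr => k _ /=.
  by have [psiM _ _] := psiP k; exact: (psiM n).1.
(* Telescoping: the [l]-th correction has bound [4 * M / 2 ^+ l], which is [8 * M] times the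
   difference of the inverses of [2 ^+ l] and [2 ^+ l.+1]. *)
have Xdist m l n (g : K -> R) B : (m <= l)%N -> 0 <= B -> (forall t, `|g t| <= B) ->
    `|X l n g - X m n g| <= 8 * M * B * ((2 ^+ m)^-1 - (2 ^+ l)^-1).
  move=> + B0 gB; elim: l => [|l IH].
    by rewrite leqn0 => /eqP ->; rewrite !subrr normr0 mulr0.
  rewrite leq_eqVlt => /orP[/eqP ->|]; first by rewrite !subrr normr0 mulr0.
  rewrite ltnS => /IH {}IH; rewrite {1}/X big_ord_recr/= -/(X l n g) addrAC.
  rewrite (le_trans (ler_normD _ _))//.
  have [psiM _ _] := psiP l; have := (psiM n).2 g B B0 gB; rewrite -/(psi l) /=.
  move: IH; rewrite [2 ^+ l.+1]exprSr invfM.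
  by move: (2 ^+ l)^-1 (2 ^+ m)^-1 => u v; lra.
have [U [UU Uoo]] := ultraFilterLemma (F := (\oo : set_system nat)) _.
have bX n (g : K -> R) : bounded_on [set: K] g -> bounded_on [set: nat] (X^~ n ^~ g).
  move=> [B gB]; pose C := Num.max 0 B.
  have C0 : 0 <= C by rewrite le_max lexx.
  exists (8 * M * C) => m _; have := Xdist 0 m n g C (leq0n m) C0.
  rewrite {2}/X big_ord0 subr0 => /(_ _)/le_trans; apply=> [t|].
    by rewrite le_max gB ?orbT.
  rewrite ler_piMr ?mulr_ge0 ?(ltW M0)// expr0 invr1 lerBlDr lerDl.
  by rewrite invr_ge0 exprn_ge0.
pose tau n g := ulim U (X^~ n ^~ g).
have tauX m n (g : K -> R) B : 0 <= B -> (forall t, `|g t| <= B) ->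
    `|tau n g - X m n g| <= 8 * M * B / 2 ^+ m.
  move=> B0 gB; apply: ulim_dist; first by apply: bX; exists B => t _.
  apply: Uoo; exists m => // l /= ml; rewrite (le_trans (Xdist _ _ _ _ _ ml B0 gB))//.
  rewrite ler_wpM2l ?mulr_ge0 ?(ltW M0)// lerBlDr lerDl.
  by rewrite invr_ge0 exprn_ge0.
exists tau; split=> [n|g cg [B0 gB0]|n f].
- split=> [a g h bg bh|g B B0 gB].
    rewrite /tau -ulim_linear; [|exact: bX..].
    by congr (ulim U _); apply/funext => m; exact: Xlin.
  have := tauX 0 n g B B0 gB.
  by rewrite /X big_ord0 subr0 expr0 divr1.
- pose B := Num.max 0 B0.
  have B_ge0 : 0 <= B by rewrite le_max lexx.
  have gB t : `|g t| <= B by rewrite le_max gB0 ?orbT.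
  apply/cvgr0Pnorm_le => e e0; have e2 : 0 < e / 2 by rewrite divr_gt0.
  (* The tail bound is uniform in [n], so a finite sum of null sequences decides the limit. *)
  have [|m me] := half_pow_lt (C := 8 * M * B) _ e2; first by rewrite !mulr_ge0 ?(ltW M0).
  have /cvgr0Pnorm_le/(_ _ e2) : X m ^~ g @ \oo --> 0.
    rewrite /X; elim: m {me} => [|m IH].
      by under eq_fun do rewrite big_ord0; exact: cvg_cst.
    under eq_fun do rewrite big_ord_recr/=.
    have psi_m : psi m ^~ g @ \oo --> 0.
      by have [_ + _] := psiP m; apply=> //; exists B => t _.
    have s0 := cvgD IH psi_m; rewrite addr0 in s0; exact: s0.
  apply: filterS => n Xn; have := tauX m n g B B_ge0 gB.
  have := ler_normD (tau n g - X m n g) (X m n g); rewrite subrK; lra.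
- apply/eqP; rewrite -subr_eq0 -normr_le0; apply/ler_addgt0Pr => e e0; rewrite add0r.
  (* The [9] is the [8] of the tail plus the [1] of the remainder [Z m]. *)
  have [|m me] := half_pow_lt (C := 9 * M * `|f|) _ e0; first by rewrite !mulr_ge0 ?(ltW M0).
  have := tauX m n (ev f) `|f| (normr_ge0 _) (ev_le f).
  have [_ /(_ n f) + _] := ZP m.
  have -> : tau n (ev f) - S n f = tau n (ev f) - X m n (ev f) - Z m n f.
    by rewrite XS; lra.
  have := ler_normB (tau n (ev f) - X m n (ev f)) (Z m n f).
  have -> : M / 2 ^+ m * `|f| = M * `|f| / 2 ^+ m by rewrite mulrAC.
  move: me; rewrite -!(mulrA _ M) -!(mulrA _ (M * _)).
  by move: (M * (`|f| / 2 ^+ m)) => u; lra.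
Qed.

End approximate_extension.

(** * Separable duals *)

Section separable_dual.
Context {R : realType} {V : normedModType R}.

Lemma dual_le (xi : dual V) (v : V) : `|v| <= 1 -> `|xi v| <= `|xi|.
Proof.
by move=> v1; apply: sup_norm_ub => //; exact: bounded_operator_bounded_on.
Qed.

Lemma dual_dense_sequence : separable (dual V) -> exists y : nat -> dual V,
  forall (xi : dual V) (e : R), 0 < e -> exists i, `|xi - y i| < e.
Proof.
move=> [D cD dD]; have D0 : D !=set0.
  by have [|xi [_ Dxi]] := dD setT _ openT; [exists 0|exists xi].
have /pfcard_geP[D00|[y]] := cD; first by move: D0; rewrite D00 => -[].
exists y => xi e e0.
have [|z [xiz Dz]] := dD (ball xi e) _ (ball_open xi e).
  by exists xi; exact: ballxx.
have [i _ yi] := 'surj_y Dz; exists i; rewrite yi.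
by move: xiz; rewrite -ball_normE.
Qed.

Lemma norming_vector (xi : dual V) : exists v : V, `|v| <= 1 /\ `|xi| <= 2 * `|xi v|.
Proof.
have [->|xi0] := eqVneq xi 0.
  by exists 0; rewrite !normr0 mulr_ge0.
have xi_gt0 : 0 < `|xi| by rewrite normr_gt0.
have hs : has_sup [set `|xi v| | v in [set v : V | `|v| <= 1]].
  split; first by exists `|xi 0|, 0 => //=; rewrite normr0.
  by exists `|xi| => _ [v v1 <-]; exact: dual_le.
have xi2 : 0 < `|xi| / 2 by rewrite divr_gt0.
have [_ [v v1 <-]] := sup_adherent xi2 hs.
rewrite -/(sup_norm _ _) -/(operator_norm xi) -[operator_norm xi]/(`|xi|) => lt.
by exists v; split=> //; lra.
Qed.

End separable_dual.

(** * Point evaluations as functionals on the subspace *)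

Section point_evaluations.
Context {d : Order.disp_t} {K : compactLineType d} {R : realType}.
Context (X : submodClosed C(K, R)).
Implicit Types (f : subnormed X) (t : K).

Definition ev f : K -> R := cfun_fun (val f).

Lemma ev_lin (a : R) f g t : ev (a *: f + g) t = a * ev f t + ev g t.
Proof. by rewrite /ev /cfun_fun !linearP. Qed.

Lemma ev_norm f : sup_norm [set: K] (ev f) = `|f|.
Proof. by []. Qed.

Lemma ev_le f t : `|ev f t| <= `|f|.
Proof. by rewrite -ev_norm; apply: sup_norm_ub => //; exact: cfun_bounded. Qed.

Lemma ev_at_subproof t :
  (fun f => ev f t) \in @bounded_operator_pred R (subnormed X) R.
Proof.
apply/asboolP; split=> [a f g|]; first exact: ev_lin.
by exists 1 => f; rewrite mul1r; exact: ev_le.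
Qed.

Definition ev_at t : dual (subnormed X) := Sub (fun f => ev f t) (ev_at_subproof t).

(** As in the proof that a space with separable dual is separable, [x i] nearly norms [y i]. If
    [xi], the difference of two evaluations, vanishes at all [x i], then a [y i] close to [xi] is
    small at [x i], hence small in norm, and so is [xi]. *)
Lemma separating_sequence (y : nat -> dual (subnormed X)) :
  (forall (xi : dual (subnormed X)) (e : R), 0 < e -> exists i, `|xi - y i| < e) ->
  exists x : nat -> subnormed X, forall u v,
    (forall i, ev (x i) u = ev (x i) v) -> forall f, ev f u = ev f v.
Proof.
move=> y_dense; have /choice[x xP] i := norming_vector (y i).
exists x => u v uv f; pose xi : dual (subnormed X) := ev_at u - ev_at v.
have xiE g : xi g = ev g u - ev g v by [].
suff xi0 : xi = 0 by apply/eqP; rewrite -subr_eq0 -xiE xi0.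
apply: contrapT => /eqP; rewrite -normr_gt0 => xi_gt0.
(* With an eighth, the norm of [xi] comes out as at most three eighths of itself. *)
have xi8 : 0 < `|xi| / 8 by rewrite divr_gt0.
have [i yi] := y_dense xi _ xi8.
have [xi1 yxi] := xP i.
have := dual_le (xi - y i) xi1.
have -> : (xi - y i : dual (subnormed X)) (x i) = xi (x i) - y i (x i) by [].
rewrite xiE uv subrr sub0r normrN => yx.
have := ler_normD (xi - y i) (y i); rewrite subrK => le; lra.
Qed.

End point_evaluations.

Theorem theorem2p4 (R : realType) (d : Order.disp_t) (K : compactLineType d)
    (X : submodClosed C(K, R)) (X_closed : closed [set f : C(K, R) | f \in X])
    (dual_separable : separable (dual (subnormed X))) :
  c0_extension_property X.
Proof.
move=> T; have [y y_dense] := dual_dense_sequence dual_separable.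
have [x x_sep] := separating_sequence y_dense.
have ev_cont (f : subnormed X) : continuous (ev f) by exact: cfun_continuous.
(* The cuts are chosen for the [x i] alone; as these separate all points that [X] separates, the
   cuts serve every element of [X]. *)
have [c [c_bot c_top c_fine]] := countable_fine (fun i => ev_cont (x i)).
have evc_fine (f : subnormed X) (e : R) : 0 < e -> exists k, fine (mkseq c k) (ev f) e.
  by move=> e0; apply: (c_fine _ _ (ev_cont f) _ e0) => u v /x_sep.
have y_bounded i : exists N : R, forall f : subnormed X, `|f| <= 1 -> `|y i f| <= N.
  by exists `|y i| => f; exact: dual_le.
have ev_dense t (e : R) : 0 < e -> exists i, forall f : subnormed X, `|f| <= 1 ->
    `|ev f t - y i f| < e.
  move=> e0; have [i yi] := y_dense (ev_at X t) e e0; exists i => f f1.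
  exact: le_lt_trans (dual_le (ev_at X t - y i) f1) yi.
have [M0 TM0] := bounded_operator_bounded T.
(* The maximum ensures the positivity that the extension lemma asks of the bound. *)
pose M := Num.max 1 M0.
have M_gt0 : 0 < M by rewrite lt_max ltr01.
pose S n (f : subnormed X) : R := (T f : c0 R) n.
have Slin n (a : R) (f g : subnormed X) : S n (a *: f + g) = a * S n f + S n g.
  by rewrite /S linearP.
have SM n (f : subnormed X) : `|S n f| <= M * `|f|.
  apply: le_trans (_ : `|T f| <= _).
    exact: (sup_norm_ub (c0_bounded (T f)) (t := n) Logic.I).
  by rewrite (le_trans (TM0 f))// ler_wpM2r// le_max lexx orbT.
have S0 (f : subnormed X) : S ^~ f @ \oo --> (0 : R) by exact: c0_cvg.
have [psi [psiM psi0 psiS]] := null_functional_extension (@ev_lin _ _ _ X) ev_cont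
  (@ev_norm _ _ _ X) (@ev_le _ _ _ X) c_bot c_top evc_fine y_bounded ev_dense
  M_gt0 Slin SM S0.
have psi_null (g : C(K, R)) : (fun n => psi n g) \in @null_pred R.
  apply/asboolP; apply: psi0; [exact: cfun_continuous|exact: cfun_bounded].
pose T' (g : C(K, R)) : c0 R := Sub (fun n => psi n g) (psi_null g).
have T'P : T' \in @bounded_operator_pred R C(K, R) (c0 R).
  apply/asboolP; split=> [a g h|].
    apply/val_inj/funext => n.
    exact: (psiM n).1 a (cfun_fun g) (cfun_fun h) (cfun_bounded g) (cfun_bounded h).
  exists (8 * M) => g; apply: sup_norm_le => [|n _].
    by rewrite mulr_ge0// mulr_ge0// ltW.
  apply: (psiM n).2 => // t.
  exact: (sup_norm_ub (cfun_bounded g) (t := t) Logic.I).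
exists (Sub T' T'P) => f; apply/val_inj/funext => n; exact: psiS.
Qed.
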